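(* Let $F=\rho(z)\|\eta\|_h$ be a conformal solution of the generalized Zermelo navigation problem with data $(h,\|u\|_h,W)$ on a domain $D\subset\mathbb{C}^n$, $n\ge2$. If $F$ is homothetic to $h$, then $h$ is locally projectively flat if and only if $F$ is locally projectively flat. Moreover, any of these assertions implies $\mathcal{K}_h=c$ for some constant $c\in\mathbb{R}$ and $\mathcal{K}_F=\frac{1}{\rho^2}c$.
   Context: On $D$ with coordinates $z=(z^k)$, $(z,\eta)$ are the induced coordinates on the holomorphic tangent bundle $T'D$; summation convention; $\dot\partial_k=\partial/\partial\eta^k$; barred indices denote conjugates. Conformal solution: the data are a Hermitian metric $h$, a smooth section $W$ of $T'D$ (the wind) and a smooth function $\|u\|_h$ on $D$ with $\|W\|_h<\|u\|_h\le1$, where $\|\eta\|_h=\sqrt{h_{i\bar j}\eta^i\bar\eta^j}$. In either of the two cases ''$W=0$'' or ''$W$ nowhere zero and $\cos\varphi=0$'' (where $\varphi=\arg h(v,\bar W)$ is the constant angle, $v$ being the resultant velocity; $\cos\varphi=0$ means that $v$ and $W$ are orthogonal), the solution of the generalized Zermelo navigation problem is the Hermitian metric $F(z,\eta)=\rho(z)\|\eta\|_h$ with $\rho=\frac{1}{\|u\|_h}$ in the first case, and $\rho=\frac{1}{\sqrt{\tilde\varepsilon}}$, $\tilde\varepsilon=\|u\|_h^2-\|W\|_h^2$, in the second. $F$ is homothetic to $h$ if $\rho$ is constant. Complex Finsler metric on a complex manifold $M$: continuous $F:T'M\to\mathbb{R}_{\ge0}$, smooth off the zero section, vanishing only there,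 $F(z,\lambda\eta)=|\lambda|F(z,\eta)$ for $\lambda\in\mathbb{C}$, with $g_{i\bar j}=\frac{\partial^2F^2}{\partial\eta^i\partial\bar\eta^j}$ positive definite. Put $N^i_j=g^{\bar m i}\frac{\partial g_{l\bar m}}{\partial z^j}\eta^l$, $L^i_{jk}=\dot\partial_jN^i_k$, $G^i=\frac12N^i_j\eta^j$, $\theta^{*i}=g^{\bar mi}g_{h\bar p}(L^{\bar p}_{\bar j\bar m}-L^{\bar p}_{\bar m\bar j})\eta^h\bar\eta^j$ (with $L^{\bar p}_{\bar j\bar m}=\overline{L^p_{jm}}$), and holomorphic curvature $\mathcal{K}_F(z,\eta)=-\frac{4}{F^4}g_{k\bar m}\frac{\partial G^k}{\partial\bar z^h}\bar\eta^h\bar\eta^m$. The Hermitian metric $h$ is regarded as the complex Finsler metric $\|\eta\|_h$, with holomorphic curvature $\mathcal{K}_h$. Two complex Finsler metrics $F,\tilde F$ on $M$ are projectively related if they have the same complex geodesics as point sets, equivalently $\tilde G^i=G^i+\frac12(\tilde\theta^{*i}-\theta^{*i})+P\eta^i$ for some smooth complex-valued function $P$. $\tilde F$ is locally Minkowski if around every point there are local charts in which $\tilde g_{i\bar j}$ depends only on $\eta$; $F$ is locally projectively flat if it is projectively related to a locally Minkowski metric. *)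

(* Defs.v *)
From HB Require Import structures.
From mathcomp Require Import all_boot all_order all_algebra.
From mathcomp Require Import all_classical all_reals all_analysis.

Set Implicit Arguments.
Unset Strict Implicit.
Unset Printing Implicit Defensive.

Import Order.TTheory GRing.Theory Num.Theory.
Import numFieldNormedType.Exports.
(* Imported last: [Re] and [Im] below are the real-valued projections of R[i]. *)
From mathcomp Require Import complex.

Local Open Scope classical_set_scope.
Local Open Scope ring_scope.
Local Open Scope complex_scope.

(* A point z of C^n is stored as the pair (Re z, Im z), so that C^n and        *)
(* C^n x C^n are normed modules over R; [coord z k] is the complex number z^k. *)
Notation Cn R n := ('rV[R]_n * 'rV[R]_n)%type.
Notation TCn R n := (Cn R n * Cn R n)%type.

Section Complex_space.
Context {R : realType} {n : nat}.

Definition coord (z : Cn R n) (k : 'I_n) : R[i] := z.1 0 k +i* z.2 0 k.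

Definition cscale (a : R[i]) (z : Cn R n) : Cn R n :=
  (Re a *: z.1 - Im a *: z.2, Re a *: z.2 + Im a *: z.1).

Definition ofcoord (c : 'I_n -> R[i]) : Cn R n :=
  (\row_k Re (c k), \row_k Im (c k)).

Definition ex (k : 'I_n) : Cn R n := (delta_mx 0 k, 0).
Definition ey (k : 'I_n) : Cn R n := (0, delta_mx 0 k).

Definition domain (D : set (Cn R n)) : Prop :=
  [/\ open D, connected D & D !=set0].

End Complex_space.

Section Calculus.
Context {R : realType} {V : normedModType R}.

(* V is finite dimensional in every use, hence a map is of class C^(k+1) on an *)
(* open set iff it is Fréchet differentiable there with C^k directional        *)
(* derivatives.                                                                *)
Fixpoint Ck (k : nat) (U : set V) (f : V -> R) : Prop :=
  if k is k'.+1 then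
    (forall x, U x -> differentiable f x) /\
    (forall v : V, Ck k' U (fun x => 'D_v f x))
  else forall x, U x -> {for x, continuous f}.

Definition smooth (U : set V) (f : V -> R) : Prop := forall k, Ck k U f.

Definition csmooth (U : set V) (f : V -> R[i]) : Prop :=
  smooth U (fun x => Re (f x)) /\ smooth U (fun x => Im (f x)).

Definition cderive (v : V) (f : V -> R[i]) (x : V) : R[i] :=
  'D_v (fun y => Re (f y)) x +i* 'D_v (fun y => Im (f y)) x.

(* The Wirtinger derivatives d/dw and d/d(conj w) in the complex coordinate w  *)
(* whose real and imaginary directions are v and v'.                           *)
Definition wirtinger (v v' : V) (f : V -> R[i]) (x : V) : R[i] :=
  2^-1 * (cderive v f x - 'i * cderive v' f x).
Definition wirtinger_bar (v v' : V) (f : V -> R[i]) (x : V) : R[i] :=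
  2^-1 * (cderive v f x + 'i * cderive v' f x).

End Calculus.

Section Holomorphic_maps.
Context {R : realType} {n : nat}.

Definition pd (k : 'I_n) (f : Cn R n -> R[i]) : Cn R n -> R[i] :=
  wirtinger (ex k) (ey k) f.
Definition pdbar (k : 'I_n) (f : Cn R n -> R[i]) : Cn R n -> R[i] :=
  wirtinger_bar (ex k) (ey k) f.

(* Smooth solutions of the Cauchy-Riemann equations. *)
Definition holomorphic (U : set (Cn R n)) (f : Cn R n -> Cn R n) : Prop :=
  forall k : 'I_n, csmooth U (fun z => coord (f z) k) /\
    forall (j : 'I_n) (z : Cn R n), U z ->
      pdbar j (fun y => coord (f y) k) z = 0.

(* The differential T'C^n -> T'C^n of a holomorphic map, in induced coordinates. *)
Definition tangent_map (f : Cn R n -> Cn R n) (x : TCn R n) : TCn R n :=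
  (f x.1,
   ofcoord (fun k => \sum_a pd a (fun y => coord (f y) k) x.1 * coord x.2 a)).

End Holomorphic_maps.

Section Finsler.
Context {R : realType} {n : nat}.

Definition herm_form (M : 'M[R[i]]_n) (v w : Cn R n) : R[i] :=
  \sum_i \sum_j M i j * coord v i * (coord w j)^*.

Definition posdef (M : 'M[R[i]]_n) : Prop :=
  forall v : Cn R n, v != 0 -> 0 < herm_form M v v.

Implicit Types (D : set (Cn R n)) (F Ft : TCn R n -> R) (x : TCn R n).

Definition dz (k : 'I_n) (f : TCn R n -> R[i]) : TCn R n -> R[i] :=
  wirtinger (ex k, 0) (ey k, 0) f.
Definition dzbar (k : 'I_n) (f : TCn R n -> R[i]) : TCn R n -> R[i] :=
  wirtinger_bar (ex k, 0) (ey k, 0) f.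
Definition deta (k : 'I_n) (f : TCn R n -> R[i]) : TCn R n -> R[i] :=
  wirtinger (0, ex k) (0, ey k) f.
Definition detabar (k : 'I_n) (f : TCn R n -> R[i]) : TCn R n -> R[i] :=
  wirtinger_bar (0, ex k) (0, ey k) f.

Definition slit D : set (TCn R n) := [set x | D x.1 /\ x.2 != 0].

(* g_{i \bar j} *)
Definition gten F (i j : 'I_n) : TCn R n -> R[i] :=
  deta i (detabar j (fun y => (F y ^+ 2)%:C)).

Definition gmx F x : 'M[R[i]]_n := \matrix_(i, j) gten F i j x.

(* g^{\bar m i}, characterized by g^{\bar m i} g_{i \bar j} = delta^m_j *)
Definition ginv F (m i : 'I_n) x : R[i] := invmx (gmx F x) m i.

Definition complex_finsler D F : Prop :=
  [/\ forall x, D x.1 -> {for x, continuous F},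
      smooth (slit D) F,
      forall x, D x.1 -> 0 <= F x /\ (F x = 0 <-> x.2 = 0),
      forall (z eta : Cn R n) (a : R[i]), D z ->
        (F (z, cscale a eta))%:C = `|a| * (F (z, eta))%:C
    & forall x, slit D x -> posdef (gmx F x)].

(* N^i_j *)
Definition Ncoef F (i j : 'I_n) x : R[i] :=
  \sum_m \sum_l ginv F m i x * dz j (gten F l m) x * coord x.2 l.

(* L^i_{jk} *)
Definition Lcoef F (i j k : 'I_n) : TCn R n -> R[i] := deta j (Ncoef F i k).

(* G^i *)
Definition spray F (i : 'I_n) x : R[i] :=
  2^-1 * \sum_j Ncoef F i j x * coord x.2 j.

(* theta^{*i} *)
Definition theta F (i : 'I_n) x : R[i] :=
  \sum_m \sum_h \sum_p \sum_j
    ginv F m i x * gten F h p x *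
    ((Lcoef F p j m x)^* - (Lcoef F p m j x)^*) *
    coord x.2 h * (coord x.2 j)^*.

Definition hol_curvature F x : R[i] :=
  - (4 / (F x ^+ 4)%:C) *
  \sum_k \sum_m \sum_h
    gten F k m x * dzbar h (spray F k) x *
    (coord x.2 h)^* * (coord x.2 m)^*.

(* The complex geodesics of F are the curves z'' + 2 G(z, z') = theta^*(z, z'); *)
(* two metrics share them as point sets iff the equation below holds. It is     *)
(* posed off the zero section, where the metrics are smooth.                    *)
Definition projectively_related D F Ft : Prop :=
  exists P : TCn R n -> R[i], csmooth (slit D) P /\
    forall (i : 'I_n) x, slit D x ->
      spray Ft i x =
        spray F i x + 2^-1 * (theta Ft i x - theta F i x) + P x * coord x.2 i.

(* The chart [phi : U -> U'] has inverse [psi : U' -> U]; the metric read in    *)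
(* the coordinates induced by the chart is [Ft \o tangent_map psi].             *)
Definition locally_minkowski D Ft : Prop :=
  forall z0, D z0 -> exists (U U' : set (Cn R n)) (phi psi : Cn R n -> Cn R n),
    [/\ [/\ open U, U z0, U `<=` D & open U'],
        [/\ holomorphic U phi, holomorphic U' psi,
            forall z, U z -> U' (phi z) /\ psi (phi z) = z
          & forall w, U' w -> U (psi w) /\ phi (psi w) = w]
      & forall (w w' zeta : Cn R n) (i j : 'I_n), U' w -> U' w' -> zeta != 0 ->
          gten (Ft \o tangent_map psi) i j (w, zeta) =
          gten (Ft \o tangent_map psi) i j (w', zeta)].

Definition locally_projectively_flat D F : Prop :=
  exists Ft, [/\ complex_finsler D Ft, locally_minkowski D Ft
               & projectively_related D F Ft].

End Finsler.

Section Navigation.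
Context {R : realType} {n : nat}.
Implicit Types (D : set (Cn R n)) (h : Cn R n -> 'M[R[i]]_n).
Implicit Types (u rho : Cn R n -> R) (W : Cn R n -> Cn R n) (F : TCn R n -> R).

Definition hermitian_metric D h : Prop :=
  [/\ forall i j, csmooth D (fun z => h z i j),
      forall z i j, D z -> h z j i = (h z i j)^*
    & forall z, D z -> posdef (h z)].

Definition hnorm h (x : TCn R n) : R :=
  Num.sqrt (Re (herm_form (h x.1) x.2 x.2)).

(* [u] is the ship's relative speed ||u||_h. *)
Definition navigation_data D h u W : Prop :=
  [/\ hermitian_metric D h, smooth D u,
      forall k, csmooth D (fun z => coord (W z) k)
    & forall z, D z -> hnorm h (z, W z) < u z /\ u z <= 1].

(* [v] is the sum of the wind and of a velocity of length u, and h(v, \bar W)   *)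
(* has argument phi.                                                            *)
Definition resultant_velocity h u W (phi : R) (z v : Cn R n) : Prop :=
  hnorm h (z, v - W z) = u z /\
  herm_form (h z) v (W z) =
    `|herm_form (h z) v (W z)| * (cos phi +i* sin phi).

(* The first clause, that the resultant velocities are F-unit vectors, is what  *)
(* the angle phi refers to; it follows from the other two.                      *)
Definition conformal_solution D h u W rho F : Prop :=
  exists phi : R,
    [/\ forall z v, D z -> resultant_velocity h u W phi z v -> F (z, v) = 1,
        (forall z, D z -> W z = 0 /\ rho z = (u z)^-1) \/
        (cos phi = 0 /\
         forall z, D z -> W z <> 0 /\
           rho z = (Num.sqrt (u z ^+ 2 - hnorm h (z, W z) ^+ 2))^-1)
      & forall z eta, D z -> F (z, eta) = rho z * hnorm h (z, eta)].

Definition homothetic D rho : Prop := exists r : R, forall z, D z -> rho z = r.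

End Navigation.

(* Main.v *)
Require Import Defs.
From HB Require Import structures.
From mathcomp Require Import all_boot all_order all_algebra.
From mathcomp Require Import all_classical all_reals all_analysis.
From mathcomp Require Import ring.
Import Order.TTheory GRing.Theory Num.Theory.
Import numFieldNormedType.Exports.
From mathcomp Require Import complex.

(* Scaling a metric by a constant changes neither the spray nor theta^*, which
   gives the equivalence. Now let h be projectively related to a locally
   Minkowski metric. In an adapted chart the latter has the fundamental tensor
   g(z, eta) = B(z)^T g_0(B(z) eta) conj(B(z)) with B holomorphic, so by Euler's
   identity its connection is A = B^-1 dB: it is linear in eta, holomorphic in z
   and symmetric, hence its theta^* vanishes. In the projective relation the
   terms of bidegree (2,0) and (1,1) in eta separate. The latter say that
   theta^* is parallel to eta; it is also h-orthogonal to eta, so it vanishes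
   and h is Kaehler. The former say that Gamma^i_{lk} - A^i_{lk} has the form
   s_l delta^i_k + s_k delta^i_l. Applying d/dzbar^j, the symmetries of a Kaehler
   curvature tensor force dbar_j s_l = kappa h_{l jbar} with kappa real, and the
   symmetry of dbar_m dbar_j s_l forces dbar kappa = 0 because n >= 2. So kappa
   is constant and the holomorphic curvature of h is -4 kappa. *)

(** Nothing is known of the factor [P] of the projective relation beyond smoothness, in particular
    no homogeneity in [eta], so [P] is never differentiated. At a fixed point it is removed by
    cross-multiplying two components with those of [eta]; replacing [eta] by ['i * eta] then
    separates the two bidegrees by pure algebra. The locally Minkowski metric is a genuine Finsler
    metric, tractable only in local charts. All that is kept of it is the array [A], which drops out
    under d/dzbar because it is holomorphic. The resulting curvature identity mentions [h] alone and
    holds on all of [D], which is what lets connectedness produce one constant. The metrics [h] and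
    [F] are treated together as [r] times the norm of [h], with [r] a positive constant; of the
    quantities compared, only the holomorphic curvature sees [r]. *)

Set Implicit Arguments.
Unset Strict Implicit.
Unset Printing Implicit Defensive.

Local Open Scope classical_set_scope.
Local Open Scope complex_scope.
Local Open Scope ring_scope.

(* [vector.coord] and [charge.cscale] shadow the names of Defs. *)
Local Notation coord := Defs.coord.
Local Notation cscale := Defs.cscale.

(** * Real calculus *)

Section Real_calculus.
Context {R : realType} {V : normedModType R}.
Implicit Types (U : set V) (f g : V -> R) (x v w : V).

(** A first-order expansion at [x] only involves values near [x], so ['d f x] serves as the
    differential of [g] as well. *)
Lemma differentiable_near_eq f g x :
  (\near x, f x = g x) -> differentiable f x -> differentiable g x.
Proof.
move=> fg df.
have fgx : f x = g x := nbhs_singleton fg.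
have E : g \o shift x = cst (g x) + 'd f x +o_ (0 : V) id.
  apply/eqaddoP => e e0.
  have H : \forall h \near (0 : V), f (h + x) = g (h + x).
    move: fg; rewrite (near_shift 0 x) subr0 /= => fg.
    exact: fg.
  have /eqaddoP/(_ _ e0) H' := diff_locally df.
  near=> h.
  rewrite [X in `|X|](_ : _ = (f \o shift x - (cst (f x) + 'd f x)) h); last first.
    by rewrite !fctE /= fgx (near H).
  by near: h.
have cd : continuous ('d f x) by exact: diff_continuous.
by apply/diff_locallyP; rewrite (diff_unique cd E).
Unshelve. all: by end_near. Qed.

Lemma open_near_eq (T : Type) U (f g : V -> T) x :
  open U -> U x -> (forall y, U y -> f y = g y) -> \near x, f x = g x.
Proof.
by move=> oU Ux fg; near=> y; apply: fg; near: y; exact: open_nbhs_nbhs.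
Unshelve. all: by end_near. Qed.

Lemma Ck_S k U f : Ck k.+1 U f -> Ck k U f.
Proof.
elim: k f => [|k IH] f [df dvf]; last by split=> // v; exact: IH (dvf v).
by move=> x Ux; apply: differentiable_continuous; exact: df.
Qed.

(** The engine of the closure properties below: the rules for sums, products and inverses give the
    derivative only at points of [U], and openness allows that formula to replace the derivative in
    the induction. *)
Lemma Ck_eq k U f g :
  open U -> (forall y, U y -> f y = g y) -> Ck k U f -> Ck k U g.
Proof.
move=> oU; elim: k f g => [|k IH] f g fg /= => [cf x Ux|[df dvf]].
  have fgx := open_near_eq oU Ux fg.
  rewrite /prop_for /continuous_at -(fg _ Ux).
  by apply: cvg_trans (cf _ Ux); apply: near_eq_cvg.
split=> [x Ux|v].
  by apply: differentiable_near_eq (df _ Ux); exact: open_near_eq fg.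
apply: IH (dvf v) => y Uy; apply: near_eq_derive; exact: open_near_eq fg.
Qed.

Lemma CkD k U f g : open U -> Ck k U f -> Ck k U g -> Ck k U (fun x => f x + g x).
Proof.
move=> oU; elim: k f g => [|k IH] f g /= => [cf cg x Ux|[df dvf] [dg dvg]].
  by apply: cvgD; [exact: cf | exact: cg].
split=> [x Ux|v]; first by apply: differentiableD; [exact: df | exact: dg].
apply: Ck_eq (IH _ _ (dvf v) (dvg v)) => // y Uy.
by rewrite -deriveD //; apply: diff_derivable; [exact: df | exact: dg].
Qed.

Lemma CkM k U f g : open U -> Ck k U f -> Ck k U g -> Ck k U (fun x => f x * g x).
Proof.
move=> oU; elim: k f g => [|k IH] f g.
  by move=> /= cf cg x Ux; apply: cvgM; [exact: cf | exact: cg].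
move=> Cf Cg; have [df dvf] := Cf; have [dg dvg] := Cg.
split=> [x Ux|v]; first by apply: differentiableM; [exact: df | exact: dg].
have C := CkD oU (IH _ _ (Ck_S Cf) (dvg v)) (IH _ _ (Ck_S Cg) (dvf v)).
apply: Ck_eq C => // y Uy.
by rewrite (@deriveM _ _ f g) //; apply: diff_derivable; [exact: df | exact: dg].
Qed.

Lemma Ck_cst k U (c : R) : Ck k U (fun=> c).
Proof.
elim: k c => [|k IH] c /= => [x _|]; first exact: cvg_cst.
split=> [x _|v]; first exact: differentiable_cst.
have -> : (fun x => 'D_v (fun=> c) x) = fun=> 0 by apply/funext => x; rewrite derive_cst.
exact: IH.
Qed.

Lemma CkV k U f : open U -> (forall x, U x -> f x != 0) -> Ck k U f ->
  Ck k U (fun x => (f x)^-1).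
Proof.
move=> oU f0; elim: k => [|k IH] => [/= cf x Ux|Cf].
  by apply: cvgV; [exact: f0 | exact: cf].
have [df dvf] := Cf; have CV := IH (Ck_S Cf).
split=> [x Ux|v]; first by apply: differentiableV; [exact: df | exact: f0].
apply: Ck_eq (CkM oU (Ck_cst k U (-1)) (CkM oU (CkM oU CV CV) (dvf v))) => // y Uy.
have := deriveV (f0 _ Uy) (diff_derivable (v := v) (df _ Uy)).
by move=> ->; rewrite expr2 invfM scaleNr mulN1r.
Qed.

Lemma smooth_differentiable U f x : smooth U f -> U x -> differentiable f x.
Proof. by move=> sf Ux; exact: (sf 1).1. Qed.

Lemma smooth_derive U f v : smooth U f -> smooth U (fun x => 'D_v f x).
Proof. by move=> sf k; exact: (sf k.+1).2. Qed.

Lemma deriveDdir f x v w : differentiable f x ->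
  'D_(v + w) f x = 'D_v f x + 'D_w f x.
Proof. by move=> df; rewrite !deriveE // linearD. Qed.

Lemma deriveZdir f x v a : differentiable f x -> 'D_(a *: v) f x = a * 'D_v f x.
Proof. by move=> df; rewrite !deriveE // linearZ. Qed.

Lemma is_derive_line f x v (t : R) : differentiable f (t *: v + x) ->
  is_derive t (1 : R) (fun s => f (s *: v + x)) ('D_v f (t *: v + x)).
Proof.
move=> df; have dv := diff_derivable (v := v) df.
have E : (fun h : R => h^-1 *: (((fun s => f (s *: v + x)) \o shift t) (h *: 1)
             - f (t *: v + x))) =
         (fun h => h^-1 *: ((f \o shift (t *: v + x)) (h *: v) - f (t *: v + x))).
  apply/funext => h /=; congr (_ *: (f _ - _)).
  by rewrite scalerDl addrA /GRing.scale /= mulr1.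
by split; rewrite /derivable /derive E.
Qed.

Lemma MVT_line f x v (t : R) : 0 < t ->
  (forall s, 0 <= s <= t -> differentiable f (s *: v + x)) ->
  exists s, 0 <= s <= t /\ f (t *: v + x) - f x = t * 'D_v f (s *: v + x).
Proof.
move=> t0 df.
have [||s] := @MVT R (fun s => f (s *: v + x)) (fun s => 'D_v f (s *: v + x)) _ _ t0.
- by move=> s; rewrite in_itv /= => /andP[s0 st]; apply/is_derive_line/df; rewrite !ltW.
- apply: derivable_within_continuous => s; rewrite in_itv /= => st.
  by have [] := is_derive_line (df _ st).
rewrite in_itv /= => /andP[s0 st] E; exists s; rewrite !ltW //; split=> //.
by move: E; rewrite scale0r add0r subr0 mulrC.
Qed.

End Real_calculus.

(** * Symmetry of second derivatives; functions with zero derivative *)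

Section Mixed_derivatives.
Context {R : realType} {V : normedModType R}.
Implicit Types (U : set V) (f g : V -> R) (x v w : V).

Lemma derive_translate f a x v : 'D_v (fun y => f (a + y)) x = 'D_v f (a + x).
Proof.
rewrite /derive.
have -> // : (fun h : R =>
    h^-1 *: (((fun y => f (a + y)) \o shift x) (h *: v) - f (a + x))) =
         (fun h => h^-1 *: ((f \o shift (a + x)) (h *: v) - f (a + x))).
by apply/funext => h /=; rewrite addrCA.
Qed.

Lemma differentiable_translate f a x :
  differentiable f (a + x) -> differentiable (fun y => f (a + y)) x.
Proof.
move=> df; apply: (@differentiable_comp _ _ _ _ (fun y => a + y) f) => //.
Qed.

(** The mean value theorem is applied twice: along [v] to the increment [g], then along [w] to
    ['D_v f]. *)
Lemma second_difference U f x v w (t : R) : smooth U f -> 0 < t ->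
  (forall s r, 0 <= s <= t -> 0 <= r <= t -> U (r *: w + (s *: v + x))) ->
  exists s r, [/\ 0 <= s <= t, 0 <= r <= t &
    f (t *: w + (t *: v + x)) - f (t *: v + x) - (f (t *: w + x) - f x) =
    t * (t * 'D_w (fun y => 'D_v f y) (r *: w + (s *: v + x)))].
Proof.
move=> sf t0 HU.
have t00 : 0 <= (0 : R) <= t by rewrite lexx ltW.
have tt : 0 <= t <= t by rewrite lexx ltW.
pose g y := f (t *: w + y) - f y.
have Uv s : 0 <= s <= t -> U (s *: v + x).
  by move=> Hs; have := HU s 0 Hs t00; rewrite scale0r add0r.
have d1 s : 0 <= s <= t -> differentiable (fun y => f (t *: w + y)) (s *: v + x).
  move=> Hs; apply: differentiable_translate; apply: smooth_differentiable sf _.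
  exact: HU.
have d2 s : 0 <= s <= t -> differentiable f (s *: v + x).
  by move=> Hs; apply: smooth_differentiable sf _; exact: Uv.
have [|s [Hs Es]] := @MVT_line _ _ g x v t t0.
  by move=> s Hs; apply: differentiableB; [exact: d1 | exact: d2].
have Dg : 'D_v g (s *: v + x) = 'D_v f (t *: w + (s *: v + x)) - 'D_v f (s *: v + x).
  by rewrite /g deriveB ?derive_translate //; apply: diff_derivable;
    [exact: d1 | exact: d2].
have [|r [Hr Er]] := @MVT_line _ _ (fun y => 'D_v f y) (s *: v + x) w t t0.
  by move=> r Hr; apply: smooth_differentiable (smooth_derive v sf) _; exact: HU.
by exists s, r; split=> //; rewrite -Er -Dg -Es.
Qed.

(* Both mixed derivatives are attained, arbitrarily near [x], by the same second
   difference divided by [t ^+ 2]. *)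
Lemma derive_comm U f x v w : open U -> smooth U f -> U x ->
  'D_v (fun y => 'D_w f y) x = 'D_w (fun y => 'D_v f y) x.
Proof.
move=> oU sf Ux; apply/eqP/negPn/negP => AB.
set A := fun y => 'D_w (fun y => 'D_v f y) y.
set B := fun y => 'D_v (fun y => 'D_w f y) y.
have cA : {for x, continuous A} := (smooth_derive w (smooth_derive v sf)) 0 x Ux.
have cB : {for x, continuous B} := (smooth_derive v (smooth_derive w sf)) 0 x Ux.
pose e := `|B x - A x| / 2.
have e0 : 0 < e by rewrite divr_gt0 // normr_gt0 subr_eq0.
have nA : \forall y \near x, `|A x - A y| < e by move/cvgrPdist_lt: cA; apply.
have nB : \forall y \near x, `|B x - B y| < e by move/cvgrPdist_lt: cB; apply.
have nU : \forall y \near x, U y by exact: open_nbhs_nbhs.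
have /nbhs_ballP[d /= d0 Hd] :
    nbhs x [set y | U y /\ `|A x - A y| < e /\ `|B x - B y| < e].
  exact: filterI nU (filterI nA nB).
(* The parallelogram at [x] with sides [t *: v] and [t *: w] must lie in the ball of radius [d]. The
   summand 1 keeps [c] positive and the bound strict. *)
pose c : R := 1 + `|v| + `|w|.
have c0 : 0 < c by rewrite /c -addrA ltr_wpDr // addr_ge0.
pose t := d / c.
have t0 : 0 < t by rewrite divr_gt0.
have tc : t * `|v| + t * `|w| < d.
  have dE : d = t * c by rewrite divfK ?lt0r_neq0.
  by rewrite [ltRHS]dE -mulrDr ltr_pM2l // /c -addrA ltrDr.
have small a b p q : 0 <= p <= t -> 0 <= q <= t -> `|a| + `|b| = `|v| + `|w| ->
    ball x d (q *: b + (p *: a + x)).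
  move=> /andP[p0 pt] /andP[q0 qt] ab; rewrite -ball_normE /= distrC addrA addrK.
  apply: le_lt_trans tc; rewrite -mulrDr -ab.
  apply: le_trans (ler_normD _ _) _; rewrite !normrZ !ger0_norm // addrC mulrDr.
  by apply: lerD; apply: ler_wpM2r.
have [|s [r [Hs Hr E1]]] := @second_difference U f x v w t sf t0.
  by move=> s r Hs Hr; have [] := Hd _ (small v w s r Hs Hr erefl).
have [|s' [r' [Hs' Hr' E2]]] := @second_difference U f x w v t sf t0.
  by move=> s' r' Hs' Hr'; have [] := Hd _ (small w v s' r' Hs' Hr' (addrC _ _)).
have [_ [HA _]] := Hd _ (small v w s r Hs Hr erefl).
have [_ [_ HB]] := Hd _ (small w v s' r' Hs' Hr' (addrC _ _)).
have subrAC4 (a b p q : R) : a - b - (p - q) = a - p - (b - q) by ring.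
rewrite subrAC4 (addrCA (t *: w)) E2 in E1.
have E : A (r *: w + (s *: v + x)) = B (r' *: v + (s' *: w + x)).
  by move/(mulfI (lt0r_neq0 t0))/(mulfI (lt0r_neq0 t0))/esym: E1.
have : `|B x - A x| < e + e.
  apply: le_lt_trans (ler_distD (A (r *: w + (s *: v + x))) _ _) _.
  by apply: ltrD; [rewrite E; exact: HB | rewrite distrC; exact: HA].
by rewrite /e -splitr ltxx.
Qed.

Lemma derive0_locally_cst f x (d : R) : 0 < d ->
  (forall y, ball x d y -> differentiable f y /\ forall v, 'D_v f y = 0) ->
  forall y, ball x d y -> f y = f x.
Proof.
move=> d0 H y; rewrite -ball_normE /= => xy.
have Hs s : 0 <= s <= 1 -> ball x d (s *: (y - x) + x).
  move=> /andP[s0 s1]; rewrite -ball_normE /= distrC addrK normrZ ger0_norm //.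
  by apply: le_lt_trans xy; rewrite distrC ler_piMl.
have [s /Hs/H[] //|s [/Hs/H[_ ->]]] := @MVT_line _ _ f x (y - x) 1 ltr01.
by rewrite scale1r subrK mulr0 => /subr0_eq.
Qed.

Lemma derive0_connected_cst U f : open U -> connected U ->
  (forall x, U x -> differentiable f x) -> (forall x v, U x -> 'D_v f x = 0) ->
  forall x y, U x -> U y -> f x = f y.
Proof.
move=> oU cU df Df x y Ux.
have loc z : U z -> exists2 d : R, 0 < d & forall y, ball z d y -> U y /\ f y = f z.
  move=> Uz; have /nbhs_ballP[d /= d0 Hd] : nbhs z U by exact: open_nbhs_nbhs.
  exists d => // y' By; split; first exact: Hd.
  apply: (derive0_locally_cst d0) By => w /Hd Uw.
  by split; [exact: df | move=> v; exact: Df].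
(* Taking a predicate as argument lets one openness proof serve both the level set of [f] through
   [x] and its complement in [U]. *)
pose E c := [set z | U z /\ c (f z)].
have oE c : open (E c).
  rewrite openE => z [Uz cz]; apply/nbhs_ballP; have [d d0 Hd] := loc z Uz.
  by exists d => // y' /Hd[Uy fy]; split; rewrite // fy.
have -> : U = E (fun c => c == f x).
  apply/esym/cU.
  - by exists x; split.
  - exists (E (fun c => c == f x)) => //.
    by apply/seteqP; split=> [z [Uz Ez]|z [Uz [_ Ez]]]; split=> //; split.
  - exists (~` E (fun c => c != f x)); first exact: open_closedC.
    apply/seteqP; split=> [z [Uz Ez]|z [Uz Ez]].
      by split=> // -[_]; rewrite Ez.
    by split=> //; apply/negPn/negP => nz; apply: Ez.
by case=> _ /eqP.
Qed.

End Mixed_derivatives.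

(** * Wirtinger calculus *)

Section Complex_numbers.
Context {R : realType}.
Implicit Types a b : R[i].

Lemma RecD a b : Re (a + b) = Re a + Re b. Proof. by case: a; case: b. Qed.
Lemma ImcD a b : Im (a + b) = Im a + Im b. Proof. by case: a; case: b. Qed.
Lemma RecM a b : Re (a * b) = Re a * Re b - Im a * Im b.
Proof. by case: a; case: b. Qed.
Lemma ImcM a b : Im (a * b) = Re a * Im b + Im a * Re b.
Proof. by case: a => ? ?; case: b => ? ? /=; rewrite addrC. Qed.
Lemma Re_conj a : Re a^* = Re a. Proof. by case: a. Qed.
Lemma Im_conj a : Im a^* = - Im a. Proof. by case: a. Qed.
Lemma complex_ext a b : Re a = Re b -> Im a = Im b -> a = b.
Proof. by case: a => ? ?; case: b => ? ? /= -> ->. Qed.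
Lemma Im_real (r : R) : Im r%:C = 0. Proof. by []. Qed.
Lemma Re_i : Re ('i%R : R[i]) = 0. Proof. by rewrite -complexiE. Qed.
Lemma Im_i : Im ('i%R : R[i]) = 1. Proof. by rewrite -complexiE. Qed.
Lemma RecV a : Re a^-1 = Re a / (Re a ^+ 2 + Im a ^+ 2). Proof. by case: a. Qed.
Lemma ImcV a : Im a^-1 = - Im a / (Re a ^+ 2 + Im a ^+ 2).
Proof. by case: a => ? ? /=; rewrite mulNr. Qed.
Lemma sqr_norm_neq0 a : a != 0 -> Re a ^+ 2 + Im a ^+ 2 != 0.
Proof. by rewrite paddr_eq0 ?sqr_ge0 // !sqrf_eq0 eq_complex. Qed.
Lemma conj_i : ('i : R[i])^* = - 'i.
Proof. exact: conjCi. Qed.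

Lemma half_double (a : R[i]) : 2^-1 * (a + a) = a.
Proof.
rewrite -mulr2n -[a *+ 2]mulr_natl mulrA mulVr ?mul1r // unitfE.
by rewrite (pnatr_eq0 R[i] 2).
Qed.

End Complex_numbers.

Section Complex_calculus.
Context {R : realType} {V : normedModType R}.
Implicit Types (U : set V) (f g : V -> R[i]) (x v w : V) (c : R[i]).

Definition cdifferentiable f x :=
  differentiable (fun y => Re (f y)) x /\ differentiable (fun y => Im (f y)) x.

Lemma csmooth_cdifferentiable U f x : csmooth U f -> U x -> cdifferentiable f x.
Proof. by move=> [Rf If] Ux; split; apply: smooth_differentiable Ux. Qed.

Lemma smooth_eq U (f g : V -> R) :
  open U -> (forall y, U y -> f y = g y) -> smooth U f -> smooth U g.
Proof. by move=> oU fg sf k; exact: Ck_eq (sf k). Qed.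

Lemma csmooth_eq U f g :
  open U -> (forall y, U y -> f y = g y) -> csmooth U f -> csmooth U g.
Proof.
move=> oU fg [Rf If]; split; [move: Rf | move: If];
  by apply: smooth_eq => // y /fg ->.
Qed.

Lemma csmooth_cst U c : csmooth U (fun=> c).
Proof. by split=> k; exact: Ck_cst. Qed.

Lemma csmoothD U f g : open U -> csmooth U f -> csmooth U g ->
  csmooth U (fun x => f x + g x).
Proof.
move=> oU [Rf If] [Rg Ig]; split=> k.
  by apply: Ck_eq (CkD oU (Rf k) (Rg k)) => // y _; rewrite RecD.
by apply: Ck_eq (CkD oU (If k) (Ig k)) => // y _; rewrite ImcD.
Qed.

Lemma csmoothM U f g : open U -> csmooth U f -> csmooth U g ->
  csmooth U (fun x => f x * g x).
Proof.
move=> oU [Rf If] [Rg Ig]; split=> k.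
  have := CkD oU (CkM oU (Rf k) (Rg k))
    (CkM oU (Ck_cst k U (-1)) (CkM oU (If k) (Ig k))).
  by apply: Ck_eq => // y _; rewrite RecM mulN1r.
have := CkD oU (CkM oU (Rf k) (Ig k)) (CkM oU (If k) (Rg k)).
by apply: Ck_eq => // y _; rewrite ImcM.
Qed.

Lemma csmoothV U f : open U -> (forall x, U x -> f x != 0) -> csmooth U f ->
  csmooth U (fun x => (f x)^-1).
Proof.
move=> oU f0 [Rf If].
have CN k : Ck k U (fun x => (Re (f x) ^+ 2 + Im (f x) ^+ 2)^-1).
  apply: CkV => // [x Ux|]; first by apply: sqr_norm_neq0; exact: f0.
  by apply: CkD => //; apply: CkM.
split=> k.
  by apply: Ck_eq (CkM oU (Rf k) (CN k)) => // y _; rewrite RecV.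
have := CkM oU (Ck_cst k U (-1)) (CkM oU (If k) (CN k)).
by apply: Ck_eq => // y _; rewrite ImcV mulN1r mulNr.
Qed.

Lemma csmooth_sum U (I : finType) (f : I -> V -> R[i]) : open U ->
  (forall i, csmooth U (f i)) -> csmooth U (fun x => \sum_i f i x).
Proof.
move=> oU sf; elim: (index_enum I) => [|i r IH].
  by apply: csmooth_eq (csmooth_cst U 0) => // y _; rewrite big_nil.
by apply: csmooth_eq (csmoothD oU (sf i) IH) => // y _; rewrite big_cons.
Qed.

Lemma csmooth_prod U (I : finType) (f : I -> V -> R[i]) : open U ->
  (forall i, csmooth U (f i)) -> csmooth U (fun x => \prod_i f i x).
Proof.
move=> oU sf; elim: (index_enum I) => [|i r IH].
  by apply: csmooth_eq (csmooth_cst U 1) => // y _; rewrite big_nil.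
by apply: csmooth_eq (csmoothM oU (sf i) IH) => // y _; rewrite big_cons.
Qed.

Lemma csmooth_det U m (A : V -> 'M[R[i]]_m) : open U ->
  (forall i j, csmooth U (fun x => A x i j)) -> csmooth U (fun x => \det (A x)).
Proof.
move=> oU sA; apply: csmooth_sum => // s.
by apply: csmoothM => //; [exact: csmooth_cst | apply: csmooth_prod].
Qed.

(** Cramer's rule: the entries of the inverse are cofactors over the determinant, hence rational
    functions of the entries of [A]. *)
Lemma csmooth_invmx U m (A : V -> 'M[R[i]]_m) i j : open U ->
  (forall i j, csmooth U (fun x => A x i j)) ->
  (forall x, U x -> A x \in unitmx) -> csmooth U (fun x => invmx (A x) i j).
Proof.
move=> oU sA uA.
suff S : csmooth U (fun x => (\det (A x))^-1 * cofactor (A x) j i).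
  by apply: csmooth_eq S => // x Ux; rewrite /invmx uA // !mxE.
apply: csmoothM => //.
  by apply: csmoothV => //; exact: csmooth_det.
rewrite /cofactor; apply: csmoothM => //; first exact: csmooth_cst.
apply: csmooth_det => // k l; apply: csmooth_eq (sA (lift j k) (lift i l)) => // x _.
by rewrite !mxE.
Qed.

Lemma cderiveD v f g x : cdifferentiable f x -> cdifferentiable g x ->
  cderive v (fun y => f y + g y) x = cderive v f x + cderive v g x.
Proof.
move=> [Rf If] [Rg Ig]; apply: complex_ext => /=.
  rewrite -deriveD; [|exact: diff_derivable..].
  by congr ('D_v _ x); apply/funext => y; rewrite RecD.
rewrite -deriveD; [|exact: diff_derivable..].
by congr ('D_v _ x); apply/funext => y; rewrite ImcD.
Qed.

Lemma cderive_cst v c x : cderive v (fun=> c) x = 0.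
Proof. by apply: complex_ext => /=; rewrite derive_cst. Qed.

Lemma cderiveM v f g x : cdifferentiable f x -> cdifferentiable g x ->
  cderive v (fun y => f y * g y) x = f x * cderive v g x + cderive v f x * g x.
Proof.
move=> [Rf If] [Rg Ig].
have Rf' := diff_derivable (v := v) Rf; have If' := diff_derivable (v := v) If.
have Rg' := diff_derivable (v := v) Rg; have Ig' := diff_derivable (v := v) Ig.
apply: complex_ext; rewrite ?RecD ?ImcD ?RecM ?ImcM /=.
  have -> : (fun y => Re (f y * g y)) =
      ((fun y => Re (f y)) * (fun y => Re (g y)) -
       (fun y => Im (f y)) * (fun y => Im (g y)))%R.
    by apply/funext => y; rewrite RecM.
  rewrite (deriveB (derivableM Rf' Rg') (derivableM If' Ig')).
  rewrite (deriveM Rf' Rg') (deriveM If' Ig') /GRing.scale /=.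
  by move: ('D_v _ x) ('D_v _ x) ('D_v _ x) ('D_v _ x) => *; ring.
have -> : (fun y => Im (f y * g y)) =
      ((fun y => Re (f y)) * (fun y => Im (g y)) +
       (fun y => Im (f y)) * (fun y => Re (g y)))%R.
  by apply/funext => y; rewrite ImcM.
rewrite (deriveD (derivableM Rf' Ig') (derivableM If' Rg')).
rewrite (deriveM Rf' Ig') (deriveM If' Rg') /GRing.scale /=.
by move: ('D_v _ x) ('D_v _ x) ('D_v _ x) ('D_v _ x) => *; ring.
Qed.

Lemma cderive_conj v f x : cdifferentiable f x ->
  cderive v (fun y => (f y)^*) x = (cderive v f x)^*.
Proof.
move=> [Rf If]; apply: complex_ext; rewrite ?Re_conj ?Im_conj /=.
  by congr ('D_v _ x); apply/funext => y; rewrite Re_conj.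
rewrite -deriveN; last exact: diff_derivable.
by congr ('D_v _ x); apply/funext => y; rewrite Im_conj.
Qed.

Lemma cderive_near v f g x : (\near x, f x = g x) -> cderive v f x = cderive v g x.
Proof.
by move=> fg; congr (_ +i* _); apply: near_eq_derive;
  apply: filterS fg => y /= ->.
Qed.

Lemma cderiveDdir v w f x : cdifferentiable f x ->
  cderive (v + w) f x = cderive v f x + cderive w f x.
Proof. by move=> [Rf If]; apply: complex_ext; rewrite /= deriveDdir. Qed.

Lemma cderiveZdir (a : R) v f x : cdifferentiable f x ->
  cderive (a *: v) f x = a%:C * cderive v f x.
Proof.
move=> [Rf If].
by apply: complex_ext; rewrite ?RecM ?ImcM /= deriveZdir // mul0r ?subr0 ?addr0.
Qed.

Lemma csmooth_cderive U v f : csmooth U f -> csmooth U (cderive v f).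
Proof. by move=> [Rf If]; split; apply: smooth_derive. Qed.

Lemma cderive_comm U v w f x : open U -> csmooth U f -> U x ->
  cderive v (cderive w f) x = cderive w (cderive v f) x.
Proof.
by move=> oU [Rf If] Ux; apply: complex_ext => /=; exact: derive_comm Ux.
Qed.

Lemma cdifferentiable_cst c x : cdifferentiable (fun=> c) x.
Proof. by split; exact: differentiable_cst. Qed.

Lemma cdifferentiableD f g x : cdifferentiable f x -> cdifferentiable g x ->
  cdifferentiable (fun y => f y + g y) x.
Proof.
move=> [Rf If] [Rg Ig]; split.
  have -> : (fun y => Re (f y + g y)) = (fun y => Re (f y)) + (fun y => Re (g y)).
    by apply/funext => y; rewrite RecD.
  exact: differentiableD.
have -> : (fun y => Im (f y + g y)) = (fun y => Im (f y)) + (fun y => Im (g y)).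
  by apply/funext => y; rewrite ImcD.
exact: differentiableD.
Qed.

Lemma cdifferentiableM f g x : cdifferentiable f x -> cdifferentiable g x ->
  cdifferentiable (fun y => f y * g y) x.
Proof.
move=> [Rf If] [Rg Ig]; split.
  have -> : (fun y => Re (f y * g y)) =
      ((fun y => Re (f y)) * (fun y => Re (g y)) -
       (fun y => Im (f y)) * (fun y => Im (g y)))%R.
    by apply/funext => y; rewrite RecM.
  by apply: differentiableB; apply: differentiableM.
have -> : (fun y => Im (f y * g y)) =
      ((fun y => Re (f y)) * (fun y => Im (g y)) +
       (fun y => Im (f y)) * (fun y => Re (g y)))%R.
  by apply/funext => y; rewrite ImcM.
by apply: differentiableD; apply: differentiableM.
Qed.

Lemma cdifferentiable_conj f x : cdifferentiable f x ->
  cdifferentiable (fun y => (f y)^*) x.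
Proof.
move=> [Rf If]; split.
  by have -> : (fun y => Re (f y)^*) = (fun y => Re (f y)) by
    apply/funext => y; rewrite Re_conj.
have -> : (fun y => Im (f y)^*) = - (fun y => Im (f y)).
  by apply/funext => y; rewrite Im_conj.
exact: differentiableN.
Qed.

(** Both Wirtinger operators at once: [c = - 'i] gives d/dw and [c = 'i] gives its conjugate, so
    each rule of calculus is proved a single time. *)
Definition dop c v v' f x : R[i] := 2^-1 * (cderive v f x + c * cderive v' f x).

Lemma wirtingerE v v' : wirtinger v v' = dop (- 'i%R) v v'.
Proof. by apply/funext => f; apply/funext => x; rewrite /dop mulNr. Qed.

Section Derivation.
Variables (c : R[i]) (v v' : V).
Local Notation d := (dop c v v').

Lemma dop_near f g x : (\near x, f x = g x) -> d f x = d g x.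
Proof. by move=> fg; rewrite /dop !(cderive_near _ fg). Qed.

Lemma dop_eq U f g x : open U -> (forall y, U y -> f y = g y) -> U x ->
  d f x = d g x.
Proof. by move=> oU fg Ux; apply: dop_near; exact: open_near_eq fg. Qed.

Lemma dop_cst a x : d (fun=> a) x = 0.
Proof. by rewrite /dop !cderive_cst mulr0 addr0 mulr0. Qed.

Lemma dopD f g x : cdifferentiable f x -> cdifferentiable g x ->
  d (fun y => f y + g y) x = d f x + d g x.
Proof.
move=> df dg; rewrite /dop !cderiveD //.
move: (cderive v f x) (cderive v g x) (cderive v' f x) (cderive v' g x).
by move: (2^-1 : R[i]) => *; ring.
Qed.

Lemma dopM f g x : cdifferentiable f x -> cdifferentiable g x ->
  d (fun y => f y * g y) x = f x * d g x + d f x * g x.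
Proof.
move=> df dg; rewrite /dop !cderiveM //.
move: (cderive v f x) (cderive v g x) (cderive v' f x) (cderive v' g x).
by move: (2^-1 : R[i]) => *; ring.
Qed.

Lemma dopMl a f x : cdifferentiable f x -> d (fun y => a * f y) x = a * d f x.
Proof.
move=> df; rewrite dopM ?dop_cst ?mul0r ?addr0 //; exact: cdifferentiable_cst.
Qed.

Lemma dopMr a f x : cdifferentiable f x -> d (fun y => f y * a) x = d f x * a.
Proof.
move=> df; rewrite dopM ?dop_cst ?mulr0 ?add0r //; exact: cdifferentiable_cst.
Qed.

Lemma cdifferentiable_sum (I : finType) (f : I -> V -> R[i]) x :
  (forall i, cdifferentiable (f i) x) -> cdifferentiable (fun y => \sum_i f i y) x.
Proof.
move=> df; elim: (index_enum I) => [|i r IH].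
  have -> : (fun y => \sum_(i <- [::]) f i y) = fun=> 0.
    by apply/funext => y; rewrite big_nil.
  exact: cdifferentiable_cst.
have -> : (fun y => \sum_(i <- i :: r) f i y) = fun y => f i y + \sum_(i <- r) f i y.
  by apply/funext => y; rewrite big_cons.
exact: cdifferentiableD.
Qed.

Lemma dop_sum (I : finType) (f : I -> V -> R[i]) x :
  (forall i, cdifferentiable (f i) x) ->
  d (fun y => \sum_i f i y) x = \sum_i d (f i) x.
Proof.
move=> df.
suff [] : cdifferentiable (fun y => \sum_i f i y) x /\
  d (fun y => \sum_i f i y) x = \sum_i d (f i) x by [].
elim: (index_enum I) => [|i r [dr IH]].
  have -> : (fun y => \sum_(i <- [::]) f i y) = fun=> 0.
    by apply/funext => y; rewrite big_nil.
  by rewrite big_nil dop_cst; split=> //; exact: cdifferentiable_cst.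
have -> : (fun y => \sum_(i <- i :: r) f i y) = fun y => f i y + \sum_(i <- r) f i y.
  by apply/funext => y; rewrite big_cons.
by rewrite big_cons dopD // IH; split=> //; exact: cdifferentiableD.
Qed.

Lemma csmooth_dop U f : open U -> csmooth U f -> csmooth U (d f).
Proof.
move=> oU sf; apply: csmoothM => //; first exact: csmooth_cst.
apply: csmoothD => //; first exact: csmooth_cderive.
by apply: csmoothM => //; [exact: csmooth_cst | exact: csmooth_cderive].
Qed.

End Derivation.

Lemma dop_conj c v v' f x : cdifferentiable f x ->
  dop c v v' (fun y => (f y)^*) x = (dop c^* v v' f x)^*.
Proof.
move=> df; rewrite /dop !cderive_conj // rmorphM rmorphD rmorphM /= conjCK.
by congr (_ * _); rewrite fmorphV rmorph_nat.
Qed.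

Lemma dop_comm U c v v' c' w w' f x : open U -> csmooth U f -> U x ->
  dop c v v' (dop c' w w' f) x = dop c' w w' (dop c v v' f) x.
Proof.
move=> oU sf Ux.
have S u : cdifferentiable (cderive u f) x.
  by apply: csmooth_cdifferentiable Ux; exact: csmooth_cderive.
have E b u u' z : cderive z (dop b u u' f) x =
    2^-1 * (cderive z (cderive u f) x + b * cderive z (cderive u' f) x).
  have K := @cdifferentiable_cst; rewrite /dop.
  rewrite cderiveM ?cderive_cst ?mul0r ?addr0 //; last first.
    by apply: cdifferentiableD => //; apply: cdifferentiableM.
  rewrite cderiveD //; last exact: cdifferentiableM.
  by rewrite cderiveM // cderive_cst mul0r addr0.
rewrite [LHS]/dop [RHS]/dop !E.
rewrite (cderive_comm w v oU sf Ux) (cderive_comm w v' oU sf Ux).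
rewrite (cderive_comm w' v oU sf Ux) (cderive_comm w' v' oU sf Ux).
move: (cderive v _ _) (cderive v _ _) (cderive v' _ _) (cderive v' _ _) (2^-1 : R[i]).
by move=> *; ring.
Qed.

End Complex_calculus.

(** * Functions on a product restricted to one factor: fibre and base of the tangent bundle *)

Section Slices.
Context {R : realType} {V1 V2 : normedModType R}.

Lemma derive_slice2 (g : V1 * V2 -> R) (v : V2) (z : V1) (e : V2) :
  'D_(0, v) g (z, e) = 'D_v (fun y => g (z, y)) e.
Proof.
rewrite /derive.
have -> // : (fun h : R => h^-1 *: ((g \o shift (z, e)) (h *: (0, v)) - g (z, e))) =
  (fun h => h^-1 *: (((fun y => g (z, y)) \o shift e) (h *: v) - g (z, e))).
apply/funext => h /=; congr (_ *: (g _ - _)).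
by transitivity (h *: (0 : V1) + z, h *: v + e) => //; rewrite scaler0 add0r.
Qed.

Lemma derive_slice1 (g : V1 * V2 -> R) (v : V1) (z : V1) (e : V2) :
  'D_(v, 0) g (z, e) = 'D_v (fun y => g (y, e)) z.
Proof.
rewrite /derive.
have -> // : (fun h : R => h^-1 *: ((g \o shift (z, e)) (h *: (v, 0)) - g (z, e))) =
  (fun h => h^-1 *: (((fun y => g (y, e)) \o shift z) (h *: v) - g (z, e))).
apply/funext => h /=; congr (_ *: (g _ - _)).
by transitivity (h *: v + z, h *: (0 : V2) + e) => //; rewrite scaler0 add0r.
Qed.

Lemma smooth_slice2 (W : set (V1 * V2)) (U : set V2)
    (z : V1) (g : V1 * V2 -> R) : smooth W g -> (forall e, U e -> W (z, e)) ->
  smooth U (fun e => g (z, e)).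
Proof.
move=> sg UW.
have dz h e : smooth W h -> U e -> differentiable (fun y => h (z, y)) e.
  move=> sh /UW We; apply: (@differentiable_comp _ _ _ _ (fun y => (z, y)) h).
    by apply: differentiable_pair => //; exact: differentiable_cst.
  exact: smooth_differentiable We.
move=> k; elim: k g sg => [|k IH] g sg /= => [e Ue|].
  by apply: differentiable_continuous; exact: dz.
split=> [e Ue|v]; first exact: dz.
have -> : (fun e => 'D_v (fun y => g (z, y)) e) = fun e => 'D_(0, v) g (z, e).
  by apply/funext => e; rewrite derive_slice2.
exact: (IH _ (smooth_derive (0, v) sg)).
Qed.

End Slices.

(** * Coordinates of C^n and the chain rule for Wirtinger derivatives *)

Section Coordinates.
Context {R : realType} {n : nat}.
Implicit Types (e z : Cn R n) (f g : Cn R n -> R[i]).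

Lemma pdE k : pd k = dop (- 'i) (ex k) (ey k) :> ((Cn R n -> R[i]) -> _).
Proof. exact: wirtingerE. Qed.

Lemma pdbarE k : pdbar k = dop 'i (ex k) (ey k) :> ((Cn R n -> R[i]) -> _).
Proof. by []. Qed.

Lemma csmooth_pd U k f : open U -> csmooth U f -> csmooth U (pd k f).
Proof. by move=> oU sf; rewrite pdE; exact: csmooth_dop. Qed.

Lemma csmooth_pdbar U k f : open U -> csmooth U f -> csmooth U (pdbar k f).
Proof. by move=> oU sf; rewrite pdbarE; exact: csmooth_dop. Qed.

Lemma pd_comm U a b f z : open U -> csmooth U f -> U z ->
  pd a (pd b f) z = pd b (pd a f) z.
Proof. by move=> oU sf Uz; rewrite !pdE; exact: dop_comm Uz. Qed.

Lemma pdbar_comm U a b f z : open U -> csmooth U f -> U z ->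
  pdbar a (pdbar b f) z = pdbar b (pdbar a f) z.
Proof. by move=> oU sf Uz; rewrite !pdbarE; exact: dop_comm Uz. Qed.

Lemma pd_pdbar_comm U a b f z : open U -> csmooth U f -> U z ->
  pd a (pdbar b f) z = pdbar b (pd a f) z.
Proof. by move=> oU sf Uz; rewrite !pdE !pdbarE; exact: dop_comm Uz. Qed.

Lemma pd_conj k f z : cdifferentiable f z ->
  pd k (fun y => (f y)^*) z = (pdbar k f z)^*.
Proof. by move=> df; rewrite pdE pdbarE dop_conj // rmorphN /= conj_i opprK. Qed.

Lemma pdbar_conj k f z : cdifferentiable f z ->
  pdbar k (fun y => (f y)^*) z = (pd k f z)^*.
Proof. by move=> df; rewrite pdE pdbarE dop_conj // conj_i. Qed.

(** The two real parts of [coord] get names so that they can carry a linear structure, from which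
    smoothness and derivatives follow. *)
Definition re_coord (k : 'I_n) (e : Cn R n) : R := e.1 0 k.
Definition im_coord (k : 'I_n) (e : Cn R n) : R := e.2 0 k.

Lemma re_coord_is_linear k : linear (re_coord k).
Proof. by move=> a e e'; rewrite /re_coord !mxE. Qed.
Lemma im_coord_is_linear k : linear (im_coord k).
Proof. by move=> a e e'; rewrite /im_coord !mxE. Qed.
HB.instance Definition _ k := GRing.isLinear.Build R (Cn R n) R _ (re_coord k)
  (re_coord_is_linear k).
HB.instance Definition _ k := GRing.isLinear.Build R (Cn R n) R _ (im_coord k)
  (im_coord_is_linear k).

Lemma re_coord_continuous k : continuous (re_coord k).
Proof.
move=> e; apply: (@continuous_comp _ _ _ fst (fun M : 'rV[R]_n => M 0 k)).
  exact: cvg_fst.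
exact: coord_continuous.
Qed.
Lemma im_coord_continuous k : continuous (im_coord k).
Proof.
move=> e; apply: (@continuous_comp _ _ _ snd (fun M : 'rV[R]_n => M 0 k)).
  exact: cvg_snd.
exact: coord_continuous.
Qed.

Lemma smooth_linear (V : normedModType R) (L : {linear V -> R}) U :
  continuous L -> smooth U L.
Proof.
move=> cL [|k] /=; first by move=> x _; exact: cL.
split=> [x _|v]; first exact: linear_differentiable.
have -> : (fun x => 'D_v L x) = fun=> L v; last exact: Ck_cst.
by apply/funext => x; rewrite deriveE ?diff_lin //; exact: linear_differentiable.
Qed.

Lemma derive_linear (V : normedModType R) (L : {linear V -> R}) (v x : V) :
  continuous L -> 'D_v L x = L v.
Proof.
by move=> cL; rewrite deriveE ?diff_lin //; exact: linear_differentiable.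
Qed.

Lemma csmooth_coord U k : csmooth U (fun e => coord e k).
Proof.
by split; [exact/(smooth_linear (L := re_coord k))/re_coord_continuous
  |exact/(smooth_linear (L := im_coord k))/im_coord_continuous].
Qed.

Lemma cdifferentiable_coord k e : cdifferentiable (fun e => coord e k) e.
Proof. exact: (csmooth_cdifferentiable (csmooth_coord setT k)). Qed.

Lemma cderive_coord v k e : cderive v (fun e => coord e k) e = coord v k.
Proof.
apply: complex_ext; first exact/(derive_linear (L := re_coord k))/re_coord_continuous.
exact/(derive_linear (L := im_coord k))/im_coord_continuous.
Qed.

Lemma coord_ex a k : coord (ex a : Cn R n) k = (k == a)%:R.
Proof.
apply: complex_ext; rewrite /coord /ex /= !mxE; first by rewrite eqxx /=; case: eqP.
by case: (k == a).
Qed.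

Lemma coord_ey a k : coord (ey a : Cn R n) k = (k == a)%:R * 'i.
Proof.
apply: complex_ext; rewrite /coord /ey ?(RecM, ImcM) ?Re_i ?Im_i /= !mxE ?eqxx /=.
  by case: (k == a); rewrite /= !(mulr0, mulr1, subr0).
by case: (k == a); rewrite /= !(mulr0, mulr1, addr0).
Qed.

Lemma pd_coord a k e : pd a (fun e => coord e k) e = (k == a)%:R.
Proof.
rewrite pdE /dop !cderive_coord coord_ex coord_ey mulrCA mulNr -expr2 sqrCi opprK mulr1.
by rewrite half_double.
Qed.

Lemma pdbar_coord a k e : pdbar a (fun e => coord e k) e = 0.
Proof.
rewrite pdbarE /dop !cderive_coord coord_ex coord_ey mulrCA -expr2 sqrCi.
by rewrite mulrN1 subrr mulr0.
Qed.

Lemma coord_ofcoord (c : 'I_n -> R[i]) k : coord (ofcoord c) k = c k.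
Proof. by rewrite /coord /ofcoord !mxE; case: (c k). Qed.

Lemma coord_inj e e' : (forall k, coord e k = coord e' k) -> e = e'.
Proof.
case: e e' => [a b] [a' b'] H; congr pair; apply/rowP => k.
  by have := congr1 (@complex.Re R) (H k).
by have := congr1 (@complex.Im R) (H k).
Qed.

Lemma coord_cscale a e k : coord (cscale a e) k = a * coord e k.
Proof.
by apply: complex_ext; rewrite ?(RecM, ImcM) /= !mxE.
Qed.

Lemma coordD e e' k : coord (e + e') k = coord e k + coord e' k.
Proof. by apply: complex_ext; rewrite ?(RecD, ImcD) /= !mxE. Qed.

Lemma coordZ (a : R) e k : coord (a *: e) k = a%:C * coord e k.
Proof.
by apply: complex_ext; rewrite ?(RecM, ImcM) /= !mxE mul0r ?subr0 ?addr0.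
Qed.

Lemma coord0 k : coord (0 : Cn R n) k = 0.
Proof. by apply: complex_ext; rewrite /= mxE. Qed.

Lemma coord_reim e k : coord e k = (e.1 0 k)%:C + (e.2 0 k)%:C * 'i.
Proof. by rewrite mulrC [LHS]complexE /= complexiE. Qed.

Lemma decomp e : e = \sum_k (e.1 0 k *: ex k + e.2 0 k *: ey k).
Proof.
apply: coord_inj => k.
rewrite (big_morph (fun e => coord e k) (fun x y => coordD x y k) (coord0 k)).
rewrite (bigD1 k) //= big1 => [|j jk]; rewrite coordD !coordZ coord_ex coord_ey.
  by rewrite eqxx mul1r mulr1 addr0 coord_reim.
by rewrite eq_sym (negPf jk) mul0r !mulr0 addr0.
Qed.

Lemma cderive_ex k f e : cderive (ex k) f e = pd k f e + pdbar k f e.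
Proof.
rewrite pdE pdbarE /dop -mulrDr -[LHS]half_double; congr (_ * _).
by move: (cderive _ f e) (cderive _ f e) => *; ring.
Qed.

Lemma cderive_ey k f e : cderive (ey k) f e = 'i * (pd k f e - pdbar k f e).
Proof.
rewrite pdE pdbarE /dop -mulrBr mulrCA -[LHS]half_double; congr (_ * _).
move: (cderive (ey k) f e) (cderive (ex k) f e) => y x.
transitivity (- ('i * 'i) * (y + y)); last by ring.
by rewrite -expr2 sqrCi opprK mul1r.
Qed.

Lemma cderive_pd v f e : cdifferentiable f e ->
  cderive v f e = \sum_k (coord v k * pd k f e + (coord v k)^* * pdbar k f e).
Proof.
move=> df; rewrite [in LHS](decomp v).
have d0 : cderive 0 f e = 0 by rewrite -(scale0r 0) cderiveZdir // mul0r.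
rewrite (big_morph (fun v => cderive v f e) (fun x y => cderiveDdir x y df) d0).
apply: eq_bigr => k _; rewrite cderiveDdir // !cderiveZdir // cderive_ex cderive_ey.
rewrite coord_reim rmorphD rmorphM /= conj_i.
have cr (r : R) : (r%:C)^* = r%:C.
  by apply: complex_ext; rewrite ?Re_conj ?Im_conj //= oppr0.
rewrite !cr; ring.
Qed.

Lemma open_neq0 : open [set e : Cn R n | e != 0].
Proof.
rewrite (_ : [set e | e != 0] = ~` [set 0]); last first.
  by apply/seteqP; split=> e /eqP.
apply: closed_openC; apply: accessible_closed_set1; apply: hausdorff_accessible.
exact: norm_hausdorff.
Qed.

Section Chain.
Context {V : normedModType R}.
Variables (b : V -> Cn R n) (x : V).
Hypothesis db : forall k, cdifferentiable (fun y => coord (b y) k) x.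

Lemma differentiable_of_coord : differentiable b x.
Proof.
have -> : b = \sum_k (fun y => Re (coord (b y) k) *: ex k + Im (coord (b y) k) *: ey k).
  by apply/funext => y; rewrite fct_sumE -decomp.
apply: differentiable_sum => k; have [dr di] := db k.
by apply: differentiableD; exact: differentiableZl.
Qed.

Lemma cdifferentiable_comp f : cdifferentiable f (b x) ->
  cdifferentiable (fun y => f (b y)) x.
Proof.
move=> [dr di]; have d := differentiable_of_coord; split.
  exact: (@differentiable_comp _ _ _ _ b (fun e => Re (f e))).
exact: (@differentiable_comp _ _ _ _ b (fun e => Im (f e))).
Qed.

Lemma cderive_comp f v : cdifferentiable f (b x) ->
  cderive v (fun y => f (b y)) x =
  \sum_k (cderive v (fun y => coord (b y) k) x * pd k f (b x) +
    cderive v (fun y => (coord (b y) k)^*) x * pdbar k f (b x)).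
Proof.
move=> df; have d := differentiable_of_coord.
have E g : cdifferentiable g (b x) ->
    cderive v (fun y => g (b y)) x = cderive ('d b x v) g (b x).
  move=> [dr di]; apply: complex_ext => /=.
    have d' := @differentiable_comp _ _ _ _ b (fun e => Re (g e)) x d dr.
    rewrite (@deriveE _ _ _ (fun y => Re (g (b y)))) // deriveE //.
    by rewrite (@diff_comp _ _ _ _ b (fun e => Re (g e))).
  have d' := @differentiable_comp _ _ _ _ b (fun e => Im (g e)) x d di.
  rewrite (@deriveE _ _ _ (fun y => Im (g (b y)))) // deriveE //.
  by rewrite (@diff_comp _ _ _ _ b (fun e => Im (g e))).
rewrite E // cderive_pd //; apply: eq_bigr => k _.
by rewrite cderive_conj // (E (fun e => coord e k)) ?cderive_coord //;
  exact: cdifferentiable_coord.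
Qed.

(** The inner map need not be holomorphic, whence two families of terms; when it is, one of them
    vanishes for each of the two Wirtinger operators. *)
Lemma dop_comp c v v' f : cdifferentiable f (b x) ->
  dop c v v' (fun y => f (b y)) x =
  \sum_k (dop c v v' (fun y => coord (b y) k) x * pd k f (b x) +
    dop c v v' (fun y => (coord (b y) k)^*) x * pdbar k f (b x)).
Proof.
move=> df; rewrite {1}/dop !cderive_comp // mulr_sumr -big_split mulr_sumr.
apply: eq_bigr => k _ /=; rewrite /dop.
move: (pd k f _) (pdbar k f _) (cderive v _ _) (cderive v' _ _).
move: (cderive v _ _) (cderive v' _ _) (2^-1 : R[i]).
by move=> *; ring.
Qed.

End Chain.

Lemma detaE k (f : TCn R n -> R[i]) z e : deta k f (z, e) = pd k (fun y => f (z, y)) e.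
Proof. by rewrite /deta /pd /wirtinger /cderive !derive_slice2. Qed.

Lemma detabarE k (f : TCn R n -> R[i]) z e :
  detabar k f (z, e) = pdbar k (fun y => f (z, y)) e.
Proof. by rewrite /detabar /pdbar /wirtinger_bar /cderive !derive_slice2. Qed.

Lemma dzE k (f : TCn R n -> R[i]) z e : dz k f (z, e) = pd k (fun y => f (y, e)) z.
Proof. by rewrite /dz /pd /wirtinger /cderive !derive_slice1. Qed.

Lemma dzbarE k (f : TCn R n -> R[i]) z e :
  dzbar k f (z, e) = pdbar k (fun y => f (y, e)) z.
Proof. by rewrite /dzbar /pdbar /wirtinger_bar /cderive !derive_slice1. Qed.

Lemma gtenE (F : TCn R n -> R) i j z e :
  gten F i j (z, e) = pd i (pdbar j (fun y => (F (z, y) ^+ 2)%:C)) e.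
Proof.
rewrite /gten detaE; congr (pd i _ e); apply/funext => y; exact: detabarE.
Qed.

End Coordinates.

(** * Hermitian metrics *)

(** Discharges the side conditions of the sum and product rules. [H] settles the atoms that are
    neither coordinates nor constants; [cdiff] passes the dummy [I] when there are none. *)
Ltac cdiff_using H := repeat first
  [ exact: H | exact: cdifferentiable_coord | exact: cdifferentiable_cst
  | apply: cdifferentiable_conj | apply: cdifferentiableM
  | apply: cdifferentiableD | apply: cdifferentiable_sum => ? ].

Ltac cdiff := cdiff_using I.

Section Coefficients.
Context {R : realType} {n : nat}.
Implicit Types (e z : Cn R n) (F : TCn R n -> R).

Lemma pd_linear_form a (c : 'I_n -> R[i]) e :
  pd a (fun y => \sum_k c k * coord y k) e = c a.
Proof.
rewrite pdE dop_sum => [|k]; last by cdiff.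
rewrite (bigD1 a) //= big1 => [|k ka]; rewrite dopMl -?pdE ?pd_coord; try by cdiff.
  by rewrite eqxx mulr1 addr0.
by rewrite (negPf ka) mulr0.
Qed.

Lemma pdbar_linear_form a (c : 'I_n -> R[i]) e :
  pdbar a (fun y => \sum_k c k * coord y k) e = 0.
Proof.
rewrite pdbarE dop_sum => [|k]; last by cdiff.
by rewrite big1 // => k _; rewrite dopMl -?pdbarE ?pdbar_coord ?mulr0 //; cdiff.
Qed.

Lemma pdbar_herm_form j (M : 'M[R[i]]_n) e :
  pdbar j (fun y => herm_form M y y) e = \sum_a M a j * coord e a.
Proof.
have -> : (fun y => herm_form M y y) =
    fun y => \sum_b (\sum_a M a b * coord y a) * (coord y b)^*.
  apply/funext => y; rewrite /herm_form exchange_big /=.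
  by apply: eq_bigr => b _; rewrite mulr_suml.
rewrite pdbarE dop_sum => [|b]; last by cdiff.
have E b : dop 'i (ex j) (ey j)
    (fun y => (\sum_a M a b * coord y a) * (coord y b)^*) e =
    (\sum_a M a b * coord e a) * (b == j)%:R.
  rewrite dopM; try by cdiff.
  rewrite -pdbarE pdbar_linear_form mul0r addr0 pdbar_conj ?pd_coord; last by cdiff.
  by rewrite rmorph_nat.
rewrite (bigD1 j) //= big1 => [|b bj]; first by rewrite E eqxx mulr1 addr0.
by rewrite E (negPf bj) mulr0.
Qed.

(** A nonzero row in the left kernel of [M] would be a vector on which the form vanishes. *)
Lemma posdef_unitmx (M : 'M[R[i]]_n) : posdef M -> M \in unitmx.
Proof.
move=> pM; rewrite unitmxE unitfE; apply/negP => /det0P[v v0 vM].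
have : ofcoord (v 0) != 0 :> Cn R n.
  apply: contra v0 => /eqP w0; apply/eqP/rowP => k.
  by rewrite -(coord_ofcoord (v 0)) w0 coord0 mxE.
move=> /pM; rewrite /herm_form exchange_big big1 ?ltxx // => j _.
rewrite -mulr_suml; have /rowP/(_ j) := vM; rewrite !mxE => E.
rewrite [X in X * _](_ : _ = 0) ?mul0r // -[RHS]E.
by apply: eq_bigr => i _; rewrite coord_ofcoord mulrC.
Qed.

Lemma mulmx_invmx (M : 'M[R[i]]_n) i k : M \in unitmx ->
  \sum_j M i j * invmx M j k = (i == k)%:R.
Proof. by move=> uM; have /matrixP/(_ i k) := mulmxV uM; rewrite !mxE. Qed.

Lemma invmx_mulmx (M : 'M[R[i]]_n) i k : M \in unitmx ->
  \sum_j invmx M i j * M j k = (i == k)%:R.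
Proof. by move=> uM; have /matrixP/(_ i k) := mulVmx uM; rewrite !mxE. Qed.

Lemma sum_delta (f : 'I_n -> R[i]) i : \sum_j f j * (j == i)%:R = f i.
Proof.
rewrite (bigD1 i) //= big1 => [|j ji]; first by rewrite eqxx mulr1 addr0.
by rewrite (negPf ji) mulr0.
Qed.

Section Linear_connection.
Variables (F : TCn R n -> R) (U : set (Cn R n)).
Variable A : 'I_n -> 'I_n -> 'I_n -> Cn R n -> R[i].
Hypothesis NA : forall i j z e, U z -> e != 0 ->
  Ncoef F i j (z, e) = \sum_l A i l j z * coord e l.

(** This section assumes only that [Ncoef] is linear in [eta], so that it covers both the Hermitian
    metric, with its Chern coefficients, and the locally Minkowski one. *)
Lemma Lcoef_linear i j k z e : U z -> e != 0 -> Lcoef F i j k (z, e) = A i j k z.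
Proof.
move=> Uz e0; rewrite /Lcoef detaE -(pd_linear_form j (fun l => A i l k z) e).
rewrite !pdE; apply: (dop_eq _ _ _ open_neq0) e0 => y y0; exact: NA.
Qed.

Lemma spray_linear i z e : U z -> e != 0 -> spray F i (z, e) =
  2^-1 * \sum_j \sum_l A i l j z * coord e l * coord e j.
Proof.
move=> Uz e0; rewrite /spray; congr (_ * _); apply: eq_bigr => j _ /=.
by rewrite NA // mulr_suml.
Qed.

Lemma theta_linear i z e : U z -> e != 0 -> theta F i (z, e) =
  \sum_m \sum_h \sum_p \sum_j ginv F m i (z, e) * gten F h p (z, e) *
    ((A p j m z)^* - (A p m j z)^*) * coord e h * (coord e j)^*.
Proof.
move=> Uz e0; rewrite /theta; do 4!(apply: eq_bigr => ? _).
by rewrite !Lcoef_linear.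
Qed.

End Linear_connection.

(* [chern h i l k] is Gamma^i_{lk} = h^{mbar i} d_k h_{l mbar}: the last index is
   the direction of derivation. *)
Definition chern (h : Cn R n -> 'M[R[i]]_n) i l k z : R[i] :=
  \sum_m invmx (h z) m i * pd k (fun y => h y l m) z.

Section Hermitian.
Variables (D : set (Cn R n)) (h : Cn R n -> 'M[R[i]]_n) (F : TCn R n -> R) (r : R).
Hypothesis oD : open D.
Hypothesis hh : hermitian_metric D h.
Hypothesis r0 : 0 < r.
Hypothesis hF : forall z e, D z -> F (z, e) = r * hnorm h (z, e).

Let r2 := (r ^+ 2)%:C.

Lemma herm_form_real z e : D z ->
  herm_form (h z) e e = (Re (herm_form (h z) e e))%:C /\ 0 <= Re (herm_form (h z) e e).
Proof.
move=> Dz; have [_ _ pd] := hh; have [->|e0] := eqVneq e 0.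
  rewrite /herm_form big1 => [|i _]; first by rewrite lexx.
  by rewrite big1 // => j _; rewrite coord0 mulr0 mul0r.
have := pd _ Dz _ e0; rewrite ltcE /= => /andP[/eqP I0 R0]; split; last exact: ltW.
by apply: complex_ext => //=; rewrite -[RHS]I0.
Qed.

Lemma hnorm_sqr z e : D z -> (hnorm h (z, e) ^+ 2)%:C = herm_form (h z) e e.
Proof. by move=> Dz; have [-> ge0] := herm_form_real e Dz; rewrite sqr_sqrtr. Qed.

Lemma hermitian_unitmx z : D z -> h z \in unitmx.
Proof. by move=> Dz; have [_ _ pd] := hh; exact/posdef_unitmx/pd. Qed.

Lemma r2_neq0 : r2 != 0.
Proof. by rewrite eq_complex /= expf_eq0 gt_eqF. Qed.

Lemma gten_hermitian i j z e : D z -> gten F i j (z, e) = r2 * h z i j.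
Proof.
move=> Dz; rewrite gtenE.
have -> : (fun y => (F (z, y) ^+ 2)%:C) = fun y => r2 * herm_form (h z) y y.
  by apply/funext => y; rewrite hF // exprMn rmorphM /= hnorm_sqr.
have -> : pdbar j (fun y => r2 * herm_form (h z) y y) =
    fun y => \sum_a (r2 * h z a j) * coord y a.
  apply/funext => y; rewrite pdbarE dopMl; last by rewrite /herm_form; cdiff.
  by rewrite -pdbarE pdbar_herm_form mulr_sumr; apply: eq_bigr => a _; rewrite mulrA.
exact: pd_linear_form.
Qed.

Lemma gmx_hermitian z e : D z -> gmx F (z, e) = r2 *: h z.
Proof. by move=> Dz; apply/matrixP => i j; rewrite !mxE gten_hermitian. Qed.

Lemma ginv_hermitian m i z e : D z -> ginv F m i (z, e) = r2^-1 * invmx (h z) m i.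
Proof.
move=> Dz; rewrite /ginv gmx_hermitian // invmxZ ?mxE //.
by rewrite unitmxZ ?hermitian_unitmx // unitfE r2_neq0.
Qed.

Lemma csmooth_h i j : csmooth D (fun y => h y i j).
Proof. by have [] := hh. Qed.

(** The constant factor [r ^+ 2] of [gten] cancels against its inverse in [ginv]; this is why the
    connection does not see [r]. *)
Lemma Ncoef_hermitian i j z e : D z ->
  Ncoef F i j (z, e) = \sum_l chern h i l j z * coord e l.
Proof.
move=> Dz; rewrite /Ncoef exchange_big /=; apply: eq_bigr => l _.
rewrite /chern mulr_suml; apply: eq_bigr => m _; congr (_ * coord e l).
rewrite (ginv_hermitian _ _ _ Dz) dzE.
have -> : pd j (fun y => gten F l m (y, e)) z = r2 * pd j (fun y => h y l m) z.
  rewrite !pdE -dopMl; last exact: csmooth_cdifferentiable (csmooth_h _ _) Dz.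
  by apply: (dop_eq _ _ _ oD) Dz => y Dy; exact: gten_hermitian.
by rewrite mulrACA mulVf ?r2_neq0 // mul1r.
Qed.

Lemma csmooth_chern i l k : csmooth D (chern h i l k).
Proof.
have [sh _ _] := hh; apply: csmooth_sum => // m; apply: csmoothM => //.
  by apply: csmooth_invmx => // z Dz; exact: hermitian_unitmx.
exact: csmooth_pd.
Qed.

Lemma spray_hermitian i z e : D z -> e != 0 -> spray F i (z, e) =
  2^-1 * \sum_j \sum_l chern h i l j z * coord e l * coord e j.
Proof. by apply: spray_linear => *; exact: Ncoef_hermitian. Qed.

Lemma theta_hermitian i z e : D z -> e != 0 -> theta F i (z, e) =
  \sum_m \sum_k \sum_p \sum_j invmx (h z) m i * h z k p *
    ((chern h p j m z)^* - (chern h p m j z)^*) * coord e k * (coord e j)^*.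
Proof.
move=> Dz e0.
rewrite (@theta_linear F D (chern h)) // => [|*]; last exact: Ncoef_hermitian.
do 4!(apply: eq_bigr => ? _); do 3!congr (_ * _).
by rewrite ginv_hermitian // gten_hermitian // mulrACA mulVf ?r2_neq0 // mul1r.
Qed.

(** The spray is independent of [r], and the [r ^+ 4] of the denominator meets one [r ^+ 2] from
    [gten], which leaves [r ^+ 2] below. *)
Lemma hol_curvature_hermitian z e : D z -> e != 0 ->
  hol_curvature F (z, e) = - (4 / (r ^+ 2 * hnorm h (z, e) ^+ 4)%:C) * (2^-1 *
    \sum_k \sum_m \sum_p \sum_j \sum_l h z k m * pdbar p (chern h k l j) z *
      coord e l * coord e j * (coord e p)^* * (coord e m)^*).
Proof.
move=> Dz e0; rewrite /hol_curvature /= hF //.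
have S k p : dzbar p (spray F k) (z, e) =
   2^-1 * \sum_j \sum_l pdbar p (chern h k l j) z * coord e l * coord e j.
  have cd l j : cdifferentiable (chern h k l j) z.
    exact: csmooth_cdifferentiable (csmooth_chern _ _ _) Dz.
  rewrite dzbarE pdbarE.
  rewrite (@dop_eq _ _ _ _ _ _ _ (fun y =>
      2^-1 * \sum_j \sum_l chern h k l j y * coord e l * coord e j) z oD) //; last first.
    by move=> y Dy; exact: spray_hermitian.
  rewrite dopMl; last by cdiff_using cd.
  congr (_ * _); rewrite dop_sum => [|j]; last by cdiff_using cd.
  apply: eq_bigr => j _; rewrite dop_sum => [|l]; last by cdiff_using cd.
  by apply: eq_bigr => l _; rewrite !dopMr //; cdiff_using cd.
have r2F : (r ^+ 2)%:C != 0 := r2_neq0.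
transitivity (- (4 / ((r * hnorm h (z, e)) ^+ 4)%:C) * (r2 * (2^-1 *
    \sum_k \sum_m \sum_p \sum_j \sum_l h z k m * pdbar p (chern h k l j) z *
      coord e l * coord e j * (coord e p)^* * (coord e m)^*))).
  congr (_ * _); rewrite !mulr_sumr; apply: eq_bigr => k _.
  rewrite !mulr_sumr; apply: eq_bigr => m _.
  rewrite !mulr_sumr; apply: eq_bigr => p _.
  rewrite S gten_hermitian // !(mulr_sumr, mulr_suml); apply: eq_bigr => j _.
  rewrite !(mulr_sumr, mulr_suml); apply: eq_bigr => l _.
  by move: (pdbar _ _ _) (2^-1 : R[i]) => *; ring.
rewrite [in LHS]mulrA; congr (_ * _).
have -> : ((r * hnorm h (z, e)) ^+ 4)%:C = r2 * (r ^+ 2 * hnorm h (z, e) ^+ 4)%:C.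
  by rewrite /r2 -rmorphM; congr (_%:C); ring.
by rewrite mulNr invfM mulrA mulrAC divfK ?r2_neq0.
Qed.

End Hermitian.
End Coefficients.

(** * Locally Minkowski metrics *)

Section Homogeneity.
Context {R : realType} {n : nat}.
Implicit Types (e z : Cn R n) (f : Cn R n -> R[i]).

Definition linmap (C : 'M[R[i]]_n) e : Cn R n :=
  ofcoord (fun k => \sum_a C k a * coord e a).

Lemma coord_linmap C e k : coord (linmap C e) k = \sum_a C k a * coord e a.
Proof. exact: coord_ofcoord. Qed.

Lemma linmapM C C' e : linmap C (linmap C' e) = linmap (C *m C') e.
Proof.
apply: coord_inj => k; rewrite !coord_linmap.
under eq_bigr do rewrite coord_linmap mulr_sumr.
rewrite exchange_big /=; apply: eq_bigr => a _; rewrite mxE mulr_suml.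
by apply: eq_bigr => b _; rewrite mulrA.
Qed.

Lemma linmap1 e : linmap 1%:M e = e.
Proof.
apply: coord_inj => k; rewrite coord_linmap (bigD1 k) //= big1 => [|a ak].
  by rewrite mxE eqxx mul1r addr0.
by rewrite mxE eq_sym (negPf ak) mul0r.
Qed.

Lemma linmap_scalar c e : linmap c%:M e = cscale c e.
Proof.
apply: coord_inj => k; rewrite coord_linmap coord_cscale (bigD1 k) //= big1 => [|a ak].
  by rewrite mxE eqxx addr0.
by rewrite mxE eq_sym (negPf ak) mul0r.
Qed.

Lemma linmap0 C : linmap C 0 = 0.
Proof.
apply: coord_inj => k; rewrite coord_linmap coord0 big1 // => a _.
by rewrite coord0 mulr0.
Qed.

Lemma linmap_neq0 C e : C \in unitmx -> e != 0 -> linmap C e != 0.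
Proof.
move=> uC; apply: contra => /eqP Ce; apply/eqP.
by rewrite -(linmap1 e) -(mulVmx uC) -linmapM Ce linmap0.
Qed.

Lemma cdifferentiable_linmap C k e :
  cdifferentiable (fun y => coord (linmap C y) k) e.
Proof.
have -> : (fun y => coord (linmap C y) k) = fun y => \sum_a C k a * coord y a.
  by apply/funext => y; rewrite coord_linmap.
by cdiff.
Qed.

Lemma pd_coord_linmap C a k e : pd a (fun y => coord (linmap C y) k) e = C k a.
Proof.
rewrite -[RHS](pd_linear_form a (C k) e); congr (pd a _ e).
by apply/funext => y; rewrite coord_linmap.
Qed.

Lemma pdbar_coord_linmap C a k e : pdbar a (fun y => coord (linmap C y) k) e = 0.
Proof.
rewrite -[RHS](pdbar_linear_form a (C k) e); congr (pdbar a _ e).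
by apply/funext => y; rewrite coord_linmap.
Qed.

Lemma pd_linmap C a f e : cdifferentiable f (linmap C e) ->
  pd a (fun y => f (linmap C y)) e = \sum_k C k a * pd k f (linmap C e).
Proof.
move=> df; have dC k := cdifferentiable_linmap C k e.
rewrite {1}pdE (dop_comp _ _ _ _ df) //; apply: eq_bigr => k _.
by rewrite -!pdE pd_coord_linmap pd_conj // pdbar_coord_linmap conjC0 mul0r addr0.
Qed.

Lemma pdbar_linmap C a f e : cdifferentiable f (linmap C e) ->
  pdbar a (fun y => f (linmap C y)) e = \sum_k (C k a)^* * pdbar k f (linmap C e).
Proof.
move=> df; have dC k := cdifferentiable_linmap C k e.
rewrite {1}pdbarE (dop_comp _ _ _ _ df) //; apply: eq_bigr => k _.
by rewrite -!pdbarE pdbar_conj // pd_coord_linmap pdbar_coord_linmap mul0r add0r.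
Qed.

Lemma pd_pdbar_linmap C a b U U' f e : open U -> open U' ->
  (forall y, U' y -> U (linmap C y)) -> csmooth U f -> U' e ->
  pd a (pdbar b (fun y => f (linmap C y))) e =
  \sum_i \sum_j C i a * (C j b)^* * pd i (pdbar j f) (linmap C e).
Proof.
move=> oU oU' UC sf Ue.
have cd g y : csmooth U g -> U' y -> cdifferentiable g (linmap C y).
  by move=> sg /UC; exact: csmooth_cdifferentiable.
have sp j : csmooth U (pdbar j f) by exact: csmooth_pdbar.
rewrite pdE (@dop_eq _ _ _ _ _ U' _
  (fun y => \sum_j (C j b)^* * pdbar j f (linmap C y)) e oU') //; last first.
  by move=> y Uy; rewrite pdbar_linmap //; exact: cd.
have cdj j : cdifferentiable (fun y => pdbar j f (linmap C y)) e.
  apply: cdifferentiable_comp; last exact: cd.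
  by move=> k; exact: cdifferentiable_linmap.
rewrite dop_sum => [|j]; last by cdiff_using cdj.
rewrite exchange_big /=; apply: eq_bigr => j _.
rewrite dopMl; last exact: cdj.
rewrite -pdE pd_linmap; last exact: cd.
by rewrite mulr_sumr; apply: eq_bigr => i _; rewrite mulrCA mulrA.
Qed.

Lemma pd_pdbarZ a b U f c e : open U -> csmooth U f -> U e ->
  pd a (pdbar b (fun y => c * f y)) e = c * pd a (pdbar b f) e.
Proof.
move=> oU sf Ue.
have cdf g y : csmooth U g -> U y -> cdifferentiable g y.
  by move=> sg; exact: csmooth_cdifferentiable.
rewrite pdE -dopMl; last exact: cdf (csmooth_pdbar b oU sf) Ue.
apply: (dop_eq _ _ _ oU) Ue => y Uy.
by rewrite pdbarE dopMl //; exact: cdf.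
Qed.

Lemma sum_scalar_mx c a b (X : 'I_n -> 'I_n -> R[i]) :
  \sum_i \sum_j (c%:M : 'M[R[i]]_n) i a * ((c%:M : 'M[R[i]]_n) j b)^* * X i j =
  c * c^* * X a b.
Proof.
rewrite (bigD1 a) //= [X in _ + X]big1 => [|k ka]; last first.
  by rewrite big1 // => l _; rewrite mxE (negPf ka) !mul0r.
rewrite (bigD1 b) //= big1 => [|k kb]; last first.
  by rewrite [c%:M k b]mxE (negPf kb) conjC0 mulr0 mul0r.
by rewrite !mxE !eqxx !addr0.
Qed.

Lemma derive_invariant (g : Cn R n -> R) e v : differentiable g e ->
  (\forall t \near (0 : R), g (t *: v + e) = g e) -> 'D_v g e = 0.
Proof.
move=> dg inv; rewrite -[e in LHS]add0r -[X in X + e](scale0r v).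
have [|_ <-] := @is_derive_line _ _ g e v 0; first by rewrite scale0r add0r.
by rewrite (near_eq_derive (g := cst (g e)) _ inv) derive_cst.
Qed.

(** Invariance kills the derivatives along [e] and along ['i * e]. The first minus ['i] times the
    second is twice the sum in question, the [pdbar] terms cancelling. *)
Lemma euler_degree0 f e : cdifferentiable f e -> e != 0 ->
  (forall a y, a != 0 -> y != 0 -> f (cscale a y) = f y) ->
  \sum_k coord e k * pd k f e = 0.
Proof.
move=> df e0 inv.
have D0 c : cderive (cscale c e) f e = 0.
  have nf : \forall t \near (0 : R), f (t *: cscale c e + e) = f e.
    (* For such [t] the scalar [t%:C * c + 1] has positive real part, hence is nonzero and
       invariance applies. *)
    have N : \forall t \near (0 : R), `|Re c| * `|t| < 1.
      have : `|Re c| * `|t| @[t --> (0 : R)] --> `|Re c| * `|0 : R|.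
        by apply: cvgMr; apply: cvg_norm; exact: cvg_id.
      by rewrite normr0 mulr0 => /cvgr_lt; apply; exact: ltr01.
    near=> t; have -> : t *: cscale c e + e = cscale (t%:C * c + 1) e.
      by apply: coord_inj => k; rewrite coordD coordZ !coord_cscale mulrDl mul1r mulrA.
    apply: inv => //; rewrite eq_complex negb_and; apply/orP; left.
    rewrite RecD RecM /= mul0r subr0 gt_eqF // -ltrBlDr sub0r.
    have : `|Re c| * `|t| < 1 by near: t.
    by rewrite -normrM mulrC ltr_norml => /andP[].
  case: df => dr di; apply: complex_ext; apply: derive_invariant => //.
    by apply: filterS nf => t ->.
  by apply: filterS nf => t ->.
have D1 := D0 1; have Di := D0 'i.
rewrite cderive_pd // in D1; rewrite cderive_pd // in Di.
rewrite -[LHS]half_double.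
have -> : \sum_k coord e k * pd k f e + \sum_k coord e k * pd k f e =
  \sum_k (coord (cscale 1 e) k * pd k f e + (coord (cscale 1 e) k)^* * pdbar k f e) -
  'i * \sum_k (coord (cscale 'i e) k * pd k f e +
    (coord (cscale 'i e) k)^* * pdbar k f e).
  rewrite mulr_sumr -sumrB -big_split /=; apply: eq_bigr => k _.
  rewrite !coord_cscale !rmorphM /= conj_i rmorph1.
  have i2 : 'i * 'i = -1 :> R[i] by rewrite -expr2 sqrCi.
  move: (coord e k) (pd k f e) (pdbar k f e) => c p q; move: (c^*) => cb.
  transitivity (c * p - ('i * 'i) * (c * p) + (cb * q + ('i * 'i) * (cb * q))).
    by rewrite i2; ring.
  by ring.
by rewrite D1 Di mulr0 subrr mulr0.
Unshelve. all: by end_near. Qed.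

Section Finsler_fibre.
Variables (D : set (Cn R n)) (F : TCn R n -> R) (z : Cn R n).
Hypothesis cF : complex_finsler D F.
Hypothesis Dz : D z.

Let phi e : R[i] := (F (z, e) ^+ 2)%:C.
Let U : set (Cn R n) := [set e | e != 0].

Lemma csmooth_sqr_fibre : csmooth U phi.
Proof.
have [_ sF _ _ _] := cF.
have s : smooth U (fun e => F (z, e)) by apply: smooth_slice2 sF _ => e.
split=> k; last exact: Ck_cst.
by apply: Ck_eq (CkM open_neq0 (s k) (s k)) => //; exact: open_neq0.
Qed.

Lemma csmooth_gten i j : csmooth U (fun e => gten F i j (z, e)).
Proof.
have -> : (fun e => gten F i j (z, e)) = pd i (pdbar j phi).
  by apply/funext => e; rewrite gtenE.
by apply: csmooth_pd; [|apply: csmooth_pdbar => //; [|exact: csmooth_sqr_fibre]];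
  exact: open_neq0.
Qed.

(** Scaling multiplies [F ^+ 2] by [a * a^*], and the chain rule for one holomorphic and one
    antiholomorphic derivative brings out the same factor. *)
Lemma gten_cscale i j a e : a != 0 -> e != 0 ->
  gten F i j (z, cscale a e) = gten F i j (z, e).
Proof.
move=> a0 e0; have [_ _ _ hF _] := cF.
have UC y : U y -> U (linmap a%:M y).
  by apply: linmap_neq0; rewrite unitmxE det_scalar unitfE expf_eq0 negb_and a0 orbT.
have := pd_pdbar_linmap i j open_neq0 open_neq0 UC csmooth_sqr_fibre e0.
have -> : (fun y => phi (linmap a%:M y)) = fun y => (a * a^*) * phi y.
  apply/funext => y; rewrite linmap_scalar /phi -normCK.
  by rewrite !rmorphXn /= hF // exprMn.
have aa : a * a^* != 0 by rewrite mulf_neq0 // conjC_eq0.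
rewrite (pd_pdbarZ i j _ open_neq0 csmooth_sqr_fibre e0).
rewrite sum_scalar_mx linmap_scalar => /(mulfI aa) E.
rewrite (gtenE _ _ _ z (cscale a e)) (gtenE _ _ _ z e).
exact: (esym E).
Qed.

(** Fibre derivatives commute, so [a] and [c] may be exchanged; what is left is Euler's identity for
    a function of degree 0. *)
Lemma euler_gten b c e : e != 0 ->
  \sum_a coord e a * pd c (fun y => gten F a b (z, y)) e = 0.
Proof.
move=> e0.
have E a : pd c (fun y => gten F a b (z, y)) e = pd a (fun y => gten F c b (z, y)) e.
  have G k : (fun y => gten F k b (z, y)) = pd k (pdbar b phi).
    by apply/funext => y; rewrite gtenE.
  have sb : csmooth U (pdbar b phi).
    by apply: csmooth_pdbar csmooth_sqr_fibre; exact: open_neq0.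
  have L := congr1 (fun f => pd c f e) (G a).
  have L' := congr1 (fun f => pd a f e) (G c).
  cbv beta in L, L'.
  have P : pd c (pd a (pdbar b phi)) e = pd a (pd c (pdbar b phi)) e.
    by move: (pd_comm c a (@open_neq0 R n) sb e0).
  apply: (etrans L); apply: (etrans P).
  exact (esym L').
under eq_bigr do rewrite E.
have cd : cdifferentiable (fun y => gten F c b (z, y)) e.
  exact: csmooth_cdifferentiable (csmooth_gten c b) e0.
by apply: (euler_degree0 cd e0) => a y a0 y0; exact: gten_cscale.
Qed.

End Finsler_fibre.
End Homogeneity.

Local Notation conjmx C := (map_mx (fun a => a^*) C).

Section Minkowski.
Context {R : realType} {n : nat}.
Implicit Types (e z : Cn R n) (D : set (Cn R n)) (F : TCn R n -> R).

Definition cjacobian (f : Cn R n -> Cn R n) z : 'M[R[i]]_n :=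
  \matrix_(k, a) pd a (fun y => coord (f y) k) z.

Lemma tangent_mapE f z e : tangent_map f (z, e) = (f z, linmap (cjacobian f z) e).
Proof.
congr pair; apply: coord_inj => k; rewrite coord_ofcoord coord_linmap.
by apply: eq_bigr => a _; rewrite mxE.
Qed.

Lemma sum_congruence (C X : 'M[R[i]]_n) a b :
  \sum_i \sum_j C i a * (C j b)^* * X i j = (C^T *m X *m conjmx C) a b.
Proof.
rewrite mxE exchange_big /=; apply: eq_bigr => j _; rewrite !mxE mulr_suml.
by apply: eq_bigr => i _; rewrite !mxE mulrAC.
Qed.

Lemma conjmxM (A B : 'M[R[i]]_n) : conjmx (A *m B) = conjmx A *m conjmx B.
Proof. exact: (map_mxM (Num.conj : {rmorphism R[i] -> R[i]})). Qed.

Lemma conjmx1 : conjmx (1%:M : 'M[R[i]]_n) = 1%:M.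
Proof. exact: (map_mx1 (Num.conj : {rmorphism R[i] -> R[i]})). Qed.

Lemma congruence_cancel (K J K0 G G0 : 'M[R[i]]_n) : K *m J = 1%:M ->
  K^T *m G *m conjmx K = K0^T *m G0 *m conjmx K0 ->
  G = (K0 *m J)^T *m G0 *m conjmx (K0 *m J).
Proof.
move=> KJ E; have := congr1 (fun X => J^T *m X *m conjmx J) E.
rewrite -!mulmxA -!conjmxM KJ conjmx1 mulmx1 !mulmxA -!trmx_mul KJ trmx1 mul1mx.
exact: id.
Qed.

Lemma cjacobian_comp_id U U' phi psi z : open U -> holomorphic U phi ->
  holomorphic U' psi -> (forall z, U z -> U' (phi z) /\ psi (phi z) = z) -> U z ->
  cjacobian psi (phi z) *m cjacobian phi z = 1%:M :> 'M[R[i]]_n.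
Proof.
move=> oU hphi hpsi phiK Uz; apply/matrixP => i j; rewrite mxE [RHS]mxE.
have -> : (i == j)%:R = pd j (fun y => coord (psi (phi y)) i) z.
  rewrite -(pd_coord j i z) !pdE; apply: (dop_eq _ _ _ oU) Uz => y /phiK[_ ->//].
have dphi k : cdifferentiable (fun y => coord (phi y) k) z.
  by have [s _] := hphi k; exact: csmooth_cdifferentiable s Uz.
have dpsi : cdifferentiable (fun y => coord (psi y) i) (phi z).
  have [s _] := hpsi i; apply: csmooth_cdifferentiable s _.
  by have [] := phiK z Uz.
rewrite [in RHS]pdE (dop_comp dphi _ _ _ dpsi); apply: eq_bigr => k _.
rewrite -!pdE pd_conj //; have [_ ->//] := hphi k.
by rewrite conjC0 mul0r addr0 !mxE mulrC.
Qed.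

Lemma gmx_tangent_map D F psi w e : complex_finsler D F -> D (psi w) ->
  cjacobian psi w \in unitmx -> e != 0 ->
  gmx (F \o tangent_map psi) (w, e) = (cjacobian psi w)^T *m
    gmx F (psi w, linmap (cjacobian psi w) e) *m conjmx (cjacobian psi w).
Proof.
move=> cF Dw uK e0; apply/matrixP => a b; rewrite mxE -sum_congruence gtenE.
have -> : (fun y => ((F \o tangent_map psi) (w, y) ^+ 2)%:C) =
    fun y => (fun y => (F (psi w, y) ^+ 2)%:C) (linmap (cjacobian psi w) y).
  by apply/funext => y; rewrite /comp tangent_mapE.
have UK y : y != 0 -> linmap (cjacobian psi w) y != 0 by exact: linmap_neq0.
have o := @open_neq0 R n.
rewrite (pd_pdbar_linmap a b o o UK (csmooth_sqr_fibre cF Dw) e0).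
apply: eq_bigr => i _; apply: eq_bigr => j _; congr (_ * _).
by rewrite mxE gtenE.
Qed.

(* The functions [chi] are the chart composed with the constant Jacobian at [z0]
   of its inverse, so that the frozen fundamental tensor is that of [F] at [z0]. *)
Lemma minkowski_chart D F z0 : complex_finsler D F -> locally_minkowski D F -> D z0 ->
  exists (U : set (Cn R n)) (chi : 'I_n -> Cn R n -> R[i]),
    let B z : 'M[R[i]]_n := \matrix_(p, i) pd i (chi p) z in
    [/\ [/\ open U, U z0 & U `<=` D],
        forall p, csmooth U (chi p) /\ forall j z, U z -> pdbar j (chi p) z = 0,
        forall z, U z -> B z \in unitmx
      & forall z e, U z -> e != 0 ->
          gmx F (z, e) = (B z)^T *m gmx F (z0, linmap (B z) e) *m conjmx (B z)].
Proof.
move=> cF mF Dz0.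
have [U [U' [phi [psi [[oU Uz0 UD oU'] [hphi hpsi phiK psiK] flat]]]]] := mF z0 Dz0.
set J := cjacobian phi; set K := cjacobian psi; set K0 := K (phi z0).
have KJ z : U z -> K (phi z) *m J z = 1%:M by exact: cjacobian_comp_id.
have uK z : U z -> K (phi z) \in unitmx.
  by move=> Uz; have [u _] := mulmx1_unit (KJ z Uz); exact u.
have uJ z : U z -> J z \in unitmx.
  by move=> Uz; have [_ u] := mulmx1_unit (KJ z Uz); exact u.
pose chi p z := \sum_a K0 p a * coord (phi z) a.
have cphi a z : U z -> cdifferentiable (fun y => coord (phi y) a) z.
  by move=> Uz; have [s _] := hphi a; exact: csmooth_cdifferentiable s Uz.
have BE z : U z -> (\matrix_(p, i) pd i (chi p) z) = K0 *m J z.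
  move=> Uz; apply/matrixP => p i; rewrite !mxE pdE.
  rewrite dop_sum => [|a]; last by cdiff_using (cphi ^~ z ^~ Uz).
  by apply: eq_bigr => a _; rewrite dopMl ?mxE ?pdE //; exact: cphi.
exists U, chi; split; first exact: And3 oU Uz0 UD.
- move=> p; split=> [|j z Uz].
    apply: csmooth_sum => // a; apply: csmoothM => //; first exact: csmooth_cst.
    by have [] := hphi a.
  rewrite pdbarE dop_sum => [|a]; last by cdiff_using (cphi ^~ z ^~ Uz).
  rewrite big1 // => a _; rewrite dopMl; last exact: cphi.
  by rewrite -pdbarE; have [_ ->//] := hphi a; rewrite mulr0.
- move=> z Uz; rewrite (BE z Uz) unitmx_mul.
  by apply/andP; split; [exact: uK z0 Uz0 | exact: uJ z Uz].
move=> z e Uz e0; rewrite (BE z Uz).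
have Je0 : linmap (J z) e != 0 by apply: linmap_neq0 e0; exact: uJ.
have [U'z pz] := phiK z Uz; have [U'z0 pz0] := phiK z0 Uz0.
(* In the chart the tensor ignores the base point, so the image of [e] may be attached to [phi z0]
   instead of [phi z]. Both sides are then pulled back by [psi]. *)
have E : gmx (F \o tangent_map psi) (phi z, linmap (J z) e) =
         gmx (F \o tangent_map psi) (phi z0, linmap (J z) e).
  apply/matrixP => a b; rewrite [LHS]mxE [RHS]mxE.
  exact: (flat _ _ _ a b U'z U'z0 Je0).
have Dz : D (psi (phi z)) by rewrite pz; exact: UD.
have Dz0' : D (psi (phi z0)) by rewrite pz0; exact: UD.
rewrite (gmx_tangent_map cF Dz (uK z Uz) Je0) in E.
rewrite (gmx_tangent_map cF Dz0' (uK z0 Uz0) Je0) in E.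
rewrite pz pz0 !linmapM in E.
have Ke : linmap (cjacobian psi (phi z) *m J z) e = e by rewrite (KJ z Uz) linmap1.
rewrite Ke in E; exact: congruence_cancel (KJ z Uz) E.
Qed.

End Minkowski.

Section Minkowski_connection.
Context {R : realType} {n : nat}.
Implicit Types (e z : Cn R n) (D : set (Cn R n)) (F : TCn R n -> R).

Lemma sum_lin (x g c : R[i]) (b d e : 'I_n -> R[i]) :
  \sum_l (x * b l + g * d l) * c * e l =
  (x * \sum_l b l * e l + g * \sum_l d l * e l) * c.
Proof.
rewrite !mulr_sumr -big_split mulr_suml; apply: eq_bigr => l _ /=; ring.
Qed.

Section Holomorphic_frame.
Variables (D : set (Cn R n)) (F : TCn R n -> R) (z0 : Cn R n) (U : set (Cn R n)).
Variable B : Cn R n -> 'M[R[i]]_n.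
Hypothesis cF : complex_finsler D F.
Hypothesis Dz0 : D z0.
Hypothesis oU : open U.
Hypothesis UD : U `<=` D.
Hypothesis sB : forall p i, csmooth U (fun y => B y p i).
Hypothesis hB : forall j p i z, U z -> pdbar j (fun y => B y p i) z = 0.
Hypothesis symB : forall j p i z, U z ->
  pd j (fun y => B y p i) z = pd i (fun y => B y p j) z.
Hypothesis uB : forall z, U z -> B z \in unitmx.
Hypothesis gB : forall z e, U z -> e != 0 ->
  gmx F (z, e) = (B z)^T *m gmx F (z0, linmap (B z) e) *m conjmx (B z).

Lemma holomorphic_frame_connection : exists A : 'I_n -> 'I_n -> 'I_n -> Cn R n -> R[i],
    [/\ forall i l k, csmooth U (A i l k),
        forall i l k z, U z -> A i l k z = A i k l z,
        forall i l k j z, U z -> pdbar j (A i l k) z = 0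
      & forall i j z e, U z -> e != 0 ->
          Ncoef F i j (z, e) = \sum_l A i l j z * coord e l].
Proof.
pose A i l j z := \sum_p invmx (B z) i p * pd j (fun y => B y p l) z.
have sA i l j : csmooth U (A i l j).
  apply: csmooth_sum => // p; apply: csmoothM => //; first exact: csmooth_invmx.
  exact: csmooth_pd.
have BA p l j z : U z -> \sum_i B z p i * A i l j z = pd j (fun y => B y p l) z.
  move=> Uz; rewrite /A; under eq_bigr do rewrite mulr_sumr.
  rewrite exchange_big /= -[RHS](sum_delta (fun q => pd j (fun y => B y q l) z)).
  apply: eq_bigr => q _; rewrite eq_sym -(mulmx_invmx p q (uB Uz)) mulr_sumr.
  by apply: eq_bigr => i _; rewrite [LHS]mulrA [LHS]mulrC.
exists A; split; first exact: sA.
- by move=> i l k z Uz; apply: eq_bigr => p _; congr (_ * _); exact: symB.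
(* Instead of differentiating the inverse matrix, [pdbar j] is applied to the relation [BA] and
   [B z] is inverted afterwards. *)
- move=> i l k j z Uz.
  have cA i' : cdifferentiable (A i' l k) z.
    exact: csmooth_cdifferentiable (sA _ _ _) Uz.
  have cB p i' : cdifferentiable (fun y => B y p i') z.
    exact: csmooth_cdifferentiable (sB _ _) Uz.
  have E p : \sum_i' B z p i' * pdbar j (A i' l k) z = 0.
    transitivity (pdbar j (fun y => \sum_i' B y p i' * A i' l k y) z).
      rewrite pdbarE dop_sum => [|i']; last exact: cdifferentiableM.
      apply: eq_bigr => i' _; rewrite dopM // -!pdbarE hB //.
      by rewrite mul0r addr0.
    transitivity (pdbar j (pd k (fun y => B y p l)) z).
      rewrite !pdbarE; apply: (dop_eq _ _ _ oU) Uz => y Uy; exact: BA.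
    rewrite -(pd_pdbar_comm k j oU (sB p l) Uz).
    transitivity (pd k (fun=> 0 : R[i]) z); last by rewrite pdE dop_cst.
    by rewrite !pdE; apply: (dop_eq _ _ _ oU) Uz => y Uy; exact: hB.
  rewrite -(sum_delta (fun i' => pdbar j (A i' l k) z)).
  transitivity (\sum_i' \sum_p invmx (B z) i p * (B z p i' * pdbar j (A i' l k) z)).
    apply: eq_bigr => i' _; rewrite eq_sym -(invmx_mulmx i i' (uB Uz)) mulr_sumr.
    by apply: eq_bigr => p _; rewrite [LHS]mulrC -[LHS]mulrA.
  by rewrite exchange_big big1 //= => p _; rewrite -mulr_sumr E mulr0.
move=> i j z e Uz e0.
have cB p i' : cdifferentiable (fun y => B y p i') z.
  exact: csmooth_cdifferentiable (sB _ _) Uz.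
pose be y := linmap (B y) e.
have bE k : (fun y => coord (be y) k) = fun y => \sum_s B y k s * coord e s.
  by apply/funext => y; rewrite coord_linmap.
have cbe k : cdifferentiable (fun y => coord (be y) k) z.
  by rewrite bE; cdiff_using cB.
have be0 : be z != 0 by apply: linmap_neq0 e0; exact: uB.
pose G p q y := gten F p q (z0, y).
have cG p q : cdifferentiable (G p q) (be z).
  exact: csmooth_cdifferentiable (csmooth_gten cF Dz0 p q) be0.
have cGb p q : cdifferentiable (fun y => G p q (be y)) z.
  exact: (cdifferentiable_comp cbe (cG p q)).
have dG p q : pd j (fun y => G p q (be y)) z =
    \sum_k pd j (fun y => coord (be y) k) z * pd k (G p q) (be z).
  rewrite pdE (dop_comp cbe _ _ _ (cG p q)); apply: eq_bigr => k _.
  rewrite -!pdE pd_conj // bE.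
  have -> : pdbar j (fun y => \sum_s B y k s * coord e s) z = 0.
    rewrite pdbarE dop_sum => [|s]; last by cdiff_using cB.
    by rewrite big1 // => s _; rewrite dopMr // -pdbarE hB // mul0r.
  by rewrite conjC0 mul0r addr0.
have dg l m : dz j (gten F l m) (z, e) = \sum_p \sum_q
    (pd j (fun y => G p q (be y)) z * B z p l +
     G p q (be z) * pd j (fun y => B y p l) z) * (B z q m)^*.
  rewrite dzE pdE.
  have EU y : U y -> gten F l m (y, e) =
      \sum_p \sum_q G p q (be y) * B y p l * (B y q m)^*.
    move=> Uy; have /matrixP/(_ l m) := gB Uy e0.
    rewrite -sum_congruence [LHS]mxE => ->.
    apply: eq_bigr => p _; apply: eq_bigr => q _.
    by rewrite [gmx _ _ p q]mxE mulrC mulrA.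
  apply: (etrans (dop_eq _ _ _ oU EU Uz)).
  have cT p q : cdifferentiable (fun y => G p q (be y) * B y p l) z.
    exact: cdifferentiableM.
  have cT' q : cdifferentiable (fun y => (B y q m)^*) z.
    exact: cdifferentiable_conj.
  have cTT p q : cdifferentiable (fun y => G p q (be y) * B y p l * (B y q m)^*) z.
    exact: cdifferentiableM.
  rewrite dop_sum => [|p]; last exact: cdifferentiable_sum.
  apply: eq_bigr => p _; rewrite dop_sum //; apply: eq_bigr => q _.
  rewrite dopM // -!pdE pd_conj // hB // conjC0 mulr0 add0r.
  by congr (_ * _); rewrite pdE dopM // addrC.
have Be p : \sum_l B z p l * coord e l = coord (be z) p by rewrite coord_linmap.
pose v p := \sum_l pd j (fun y => B y p l) z * coord e l.
have sum_dg m : \sum_l dz j (gten F l m) (z, e) * coord e l =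
    \sum_p \sum_q G p q (be z) * v p * (B z q m)^*.
  have euler q : \sum_p pd j (fun y => G p q (be y)) z * coord (be z) p = 0.
    under eq_bigr do rewrite dG mulr_suml.
    rewrite exchange_big big1 //= => k _.
    transitivity (pd j (fun y => coord (be y) k) z *
        \sum_p coord (be z) p * pd k (G p q) (be z)).
      rewrite mulr_sumr; apply: eq_bigr => p _.
      by rewrite -mulrA [X in _ * X]mulrC.
    by rewrite (euler_gten cF Dz0 q k be0) mulr0.
  transitivity (\sum_p \sum_q (pd j (fun y => G p q (be y)) z * coord (be z) p +
      G p q (be z) * v p) * (B z q m)^*).
    under eq_bigr do rewrite dg mulr_suml.
    rewrite exchange_big; apply: eq_bigr => p _ /=.
    under eq_bigr do rewrite mulr_suml.
    rewrite exchange_big; apply: eq_bigr => q _ /=.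
    by rewrite -Be; exact: sum_lin.
  rewrite exchange_big [RHS]exchange_big; apply: eq_bigr => q _ /=.
  under eq_bigr do rewrite mulrDl.
  by rewrite big_split /= -mulr_suml euler mul0r add0r.
pose a k := \sum_l A k l j z * coord e l.
have va p : v p = \sum_k B z p k * a k.
  rewrite /v /a; under [RHS]eq_bigr do rewrite mulr_sumr.
  rewrite exchange_big; apply: eq_bigr => l _ /=.
  by rewrite -BA // mulr_suml; apply: eq_bigr => k _; rewrite mulrA.
have ug : gmx F (z, e) \in unitmx.
  apply: posdef_unitmx; have [_ _ _ _ pd] := cF; apply: pd; split=> //; exact: UD.
(* Since [v] is the image of [a] under [B z], the surviving term is the tensor at [(z, e)] itself
   applied to [a]; its inverse in [Ncoef] then returns [a i]. *)
have sum_dg' m : \sum_l dz j (gten F l m) (z, e) * coord e l =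
    \sum_k a k * gmx F (z, e) k m.
  rewrite sum_dg (gB Uz e0).
  under [RHS]eq_bigr do rewrite -sum_congruence mulr_sumr.
  rewrite [RHS]exchange_big; apply: eq_bigr => p _ /=.
  under [RHS]eq_bigr do rewrite mulr_sumr.
  rewrite [RHS]exchange_big; apply: eq_bigr => q _ /=.
  rewrite va mulr_sumr mulr_suml; apply: eq_bigr => k _ /=.
  rewrite [gmx _ _ p q]mxE -/(be z) -/(G p q (be z)).
  by move: (G p q (be z)) (B z p k) ((B z q m)^*) (a k) => *; ring.
rewrite -/(a i) /Ncoef.
transitivity (\sum_m ginv F m i (z, e) * \sum_k a k * gmx F (z, e) k m).
  apply: eq_bigr => m _; rewrite -sum_dg' mulr_sumr.
  by apply: eq_bigr => l _; rewrite mulrA.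
under eq_bigr do rewrite mulr_sumr.
rewrite exchange_big /= -[RHS](sum_delta a); apply: eq_bigr => k _.
rewrite -(mulmx_invmx k i ug) mulr_sumr; apply: eq_bigr => m _.
by rewrite /ginv [LHS]mulrC -[LHS]mulrA.
Qed.

End Holomorphic_frame.

(** The frame is the Jacobian of the functions [chi]: [symB] is the symmetry of their second
    derivatives, and [hB] comes from their holomorphy. *)
Lemma minkowski_connection D F z0 :
  complex_finsler D F -> locally_minkowski D F -> D z0 ->
  exists (U : set (Cn R n)) (A : 'I_n -> 'I_n -> 'I_n -> Cn R n -> R[i]),
    [/\ [/\ open U, U z0 & U `<=` D],
        forall i l k, csmooth U (A i l k),
        forall i l k z, U z -> A i l k z = A i k l z,
        forall i l k j z, U z -> pdbar j (A i l k) z = 0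
      & forall i j z e, U z -> e != 0 ->
          Ncoef F i j (z, e) = \sum_l A i l j z * coord e l].
Proof.
move=> cF mF Dz0; have [U [chi [[oU Uz0 UD] hchi uB gB]]] := minkowski_chart cF mF Dz0.
pose B : Cn R n -> 'M[R[i]]_n := fun z => \matrix_(p, i) pd i (chi p) z.
have BE p i : (fun y => B y p i) = pd i (chi p).
  by apply/funext => y; rewrite mxE.
have schi p : csmooth U (chi p) by have [] := hchi p.
have sB p i : csmooth U (fun y => B y p i) by rewrite BE; exact: csmooth_pd.
have hB j p i z : U z -> pdbar j (fun y => B y p i) z = 0.
  move=> Uz; rewrite BE -(pd_pdbar_comm i j oU (schi p) Uz).
  transitivity (pd i (fun=> 0 : R[i]) z); last by rewrite pdE dop_cst.
  rewrite !pdE; apply: (dop_eq _ _ _ oU) Uz => y Uy.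
  by have [_ ->] := hchi p.
have symB j p i z : U z -> pd j (fun y => B y p i) z = pd i (fun y => B y p j) z.
  by move=> Uz; rewrite !BE; exact: pd_comm Uz.
have [A [sA syA hA NA]] := holomorphic_frame_connection cF Dz0 oU UD sB hB symB uB gB.
by exists U, A; split.
Qed.

End Minkowski_connection.

(** * The projective relation at a point *)

Section Polarization.
Context {R : realType} {n : nat}.
Local Notation C := R[i].
Implicit Types (c d : 'I_n -> C) (a b : 'I_n).

Lemma sum_delta2 c x y a b :
  \sum_k c k * (x * (k == a)%:R + y * (k == b)%:R) = x * c a + y * c b.
Proof.
rewrite -[c a in RHS](sum_delta c) -[c b in RHS](sum_delta c) !mulr_sumr -big_split.
by apply: eq_bigr => k _ /=; ring.
Qed.

(** On combinations of the unit vectors [a] and [b], the weights [1, 1] give [S a b + S b a = 0],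
    while [1, 'i] give [S b a = S a b]. *)
Lemma sesquilinear_eq0 (S : 'I_n -> 'I_n -> C) :
  (forall c, \sum_k \sum_j S k j * c k * (c j)^* = 0) -> forall a b, S a b = 0.
Proof.
move=> S0 a b.
have E x y : x * x^* * S a a + x * y^* * S a b + (y * x^* * S b a + y * y^* * S b b) = 0.
  rewrite -[RHS](S0 (fun k => x * (k == a)%:R + y * (k == b)%:R)).
  transitivity (\sum_k (x^* * S k a + y^* * S k b) * (x * (k == a)%:R + y * (k == b)%:R)).
    by rewrite sum_delta2; ring.
  apply: eq_bigr => k _; rewrite -(sum_delta2 (S k)) mulr_suml; apply: eq_bigr => j _.
  by rewrite rmorphD !rmorphM !rmorph_nat /=; ring.
have Eaa := E 1 0; have Ebb := E 0 1; have E1 := E 1 1; have Ei := E 1 'i.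
rewrite !(rmorph0, rmorph1, conj_i, mul0r, mulr0, mul1r, mulr1, add0r, addr0)
  in Eaa Ebb E1 Ei.
rewrite Eaa Ebb !(mulr0, addr0, add0r) in E1 Ei.
have ab : S b a = S a b.
  have /eqP : 'i * (S b a - S a b) = 0 by rewrite -Ei; ring.
  by rewrite mulf_eq0 (negPf (neq0Ci _)) /= subr_eq0 => /eqP.
by rewrite ab in E1; rewrite -[S a b]half_double E1 mulr0.
Qed.

Lemma symmetric_form_eq0 (S : 'I_n -> 'I_n -> C) : (forall a b, S a b = S b a) ->
  (forall c, \sum_k \sum_j S k j * c k * c j = 0) -> forall a b, S a b = 0.
Proof.
move=> sS S0 a b.
have E x y : x * x * S a a + x * y * S a b + (y * x * S a b + y * y * S b b) = 0.
  rewrite -[RHS](S0 (fun k => x * (k == a)%:R + y * (k == b)%:R)).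
  transitivity (\sum_k (x * S k a + y * S k b) * (x * (k == a)%:R + y * (k == b)%:R)).
    by rewrite sum_delta2 (sS b a); ring.
  apply: eq_bigr => k _; rewrite -(sum_delta2 (S k)) mulr_suml; apply: eq_bigr => j _.
  by ring.
have Eaa := E 1 0; have Ebb := E 0 1; have E1 := E 1 1.
rewrite !(mul0r, mulr0, mul1r, mulr1, add0r, addr0) in Eaa Ebb E1.
rewrite Eaa Ebb add0r addr0 in E1.
by rewrite -[S a b]half_double E1 mulr0.
Qed.

(* Polarise, put the j-th unit vector in the second slot and sum over j: this
   identifies the linear form as a trace. *)
Lemma radial_quadratic_map (S : 'I_n -> 'I_n -> 'I_n -> C) :
  (forall i l k, S i l k = S i k l) ->
  (forall c i j, (\sum_l \sum_k S i l k * c l * c k) * c j =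
                 (\sum_l \sum_k S j l k * c l * c k) * c i) ->
  forall i l k, n.+1%:R * S i l k =
    (\sum_m S m m l) * (i == k)%:R + (\sum_m S m m k) * (i == l)%:R.
Proof.
move=> sS rad i l k; pose t l := \sum_m S m m l.
pose Q i c := \sum_l \sum_k S i l k * c l * c k.
pose B i c d := \sum_l \sum_k S i l k * c l * d k.
have Qx i' c d x : Q i' (fun k => c k + x * d k) =
    Q i' c + 2 * x * B i' c d + x * x * Q i' d.
  have -> : 2 * x * B i' c d = x * B i' c d + x * B i' d c.
    have -> : B i' d c = B i' c d; last by rewrite -mulrA mulr_natl mulr2n.
    rewrite /B exchange_big; apply: eq_bigr => l' _; apply: eq_bigr => k' _.
    by rewrite sS mulrAC.
  rewrite addrA /Q /B !mulr_sumr -!big_split; apply: eq_bigr => l' _ /=.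
  rewrite !mulr_sumr -!big_split; apply: eq_bigr => k' _ /=; ring.
(* The relation is cubic in its vector. Half the difference of its instances at [c + d] and [c - d]
   keeps the terms odd in [d]; subtracting the instance at [d] leaves the linear ones. *)
have pol i' j c d : 2 * B i' c d * c j + Q i' c * d j = 2 * B j c d * c i' + Q j c * d i'.
  have r1 := rad (fun k => c k + 1 * d k) i' j.
  have r2 := rad (fun k => c k + -1 * d k) i' j.
  rewrite -!/(Q _ _) !Qx in r1 r2.
  have rc := rad c i' j; have rd := rad d i' j; rewrite -!/(Q _ _) in rc rd.
  apply/subr0_eq; rewrite -[LHS]half_double.
  move: (Q i' c) (Q j c) (Q i' d) (Q j d) (B i' c d) (B j c d) r1 r2 rc rd.
  move: (c j) (c i') (d j) (d i') (2^-1 : C) => cj ci dj di h.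
  move=> qi qj qi' qj' bi bj r1 r2 rc rd.
  transitivity (h * (((qi + 2 * 1 * bi + 1 * 1 * qi') * (cj + 1 * dj) -
    (qj + 2 * 1 * bj + 1 * 1 * qj') * (ci + 1 * di)) -
    ((qi + 2 * -1 * bi + -1 * -1 * qi') * (cj + -1 * dj) -
    (qj + 2 * -1 * bj + -1 * -1 * qj') * (ci + -1 * di)) - 2 * (qi' * dj - qj' * di))).
    by ring.
  by rewrite r1 r2 rd !subrr; ring.
(* Summation over [j] gives [2 * Q + n * Q] on the left, and on the right [Q] plus twice the trace
   form times [c i]; hence the factor [n.+1]. *)
have Qt c : n.+1%:R * Q i c = 2 * (\sum_l t l * c l) * c i.
  have BE i' j : B i' c (fun k => (k == j)%:R) = \sum_l S i' l j * c l.
    apply: eq_bigr => l' _; exact: (sum_delta (fun k => S i' l' k * c l')).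
  have : \sum_j (2 * B i c (fun k => (k == j)%:R) * c j + Q i c * (j == j)%:R) =
         \sum_j (2 * B j c (fun k => (k == j)%:R) * c i + Q j c * (i == j)%:R).
    by apply: eq_bigr => j _; exact: pol.
  rewrite !big_split /=.
  have -> : \sum_j 2 * B i c (fun k => (k == j)%:R) * c j = 2 * Q i c.
    rewrite /Q exchange_big mulr_sumr; apply: eq_bigr => j _ /=.
    by rewrite BE -mulrA mulr_suml.
  have -> : \sum_(j < n) Q i c * (j == j)%:R = n%:R * Q i c.
    transitivity (\sum_(j < n) Q i c); first by apply: eq_bigr => j _; rewrite eqxx mulr1.
    by rewrite sumr_const card_ord mulr_natl.
  have -> : \sum_j 2 * B j c (fun k => (k == j)%:R) * c i = 2 * (\sum_l t l * c l) * c i.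
    rewrite -mulr_suml -mulr_sumr; congr (2 * _ * _).
    under eq_bigr do rewrite BE.
    rewrite exchange_big; apply: eq_bigr => l' _ /=.
    by rewrite /t mulr_suml; apply: eq_bigr => m _; rewrite sS.
  have -> : \sum_j Q j c * (i == j)%:R = Q i c.
    by under eq_bigr do rewrite eq_sym; rewrite (sum_delta (fun j => Q j c)).
  by rewrite -[n.+1]addn1 natrD => E; apply: (addIr (Q i c)); rewrite -E; ring.
apply/subr0_eq; rewrite -/(t l) -/(t k).
apply: (symmetric_form_eq0 (S := fun l k =>
   n.+1%:R * S i l k - (t l * (i == k)%:R + t k * (i == l)%:R))) => [l' k'|c].
  by rewrite (sS i l' k') (addrC (t l' * _)).
transitivity (n.+1%:R * Q i c - 2 * (\sum_l t l * c l) * c i); last by rewrite Qt subrr.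
have e1 : \sum_l' \sum_k' t l' * (i == k')%:R * c l' * c k' = (\sum_l t l * c l) * c i.
  rewrite mulr_suml; apply: eq_bigr => l' _; rewrite -(sum_delta c i) mulr_sumr.
  by apply: eq_bigr => k' _; rewrite eq_sym; ring.
have e2 : \sum_l' \sum_k' t k' * (i == l')%:R * c l' * c k' = (\sum_l t l * c l) * c i.
  rewrite exchange_big -e1; apply: eq_bigr => l' _; apply: eq_bigr => k' _ /=; ring.
rewrite -mulrA [2 * _]mulr_natl mulr2n -{1}e1 -e2 /Q !mulr_sumr -big_split -sumrB.
apply: eq_bigr => l' _ /=; rewrite !mulr_sumr -big_split -sumrB.
by apply: eq_bigr => k' _ /=; ring.
Qed.

End Polarization.

Section Projective_relation.
Context {R : realType} {n : nat}.
Local Notation C := R[i].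
Variables (M : 'M[C]_n) (G A : 'I_n -> 'I_n -> 'I_n -> C).
Hypothesis pM : posdef M.
Hypothesis sA : forall i l k, A i l k = A i k l.

Let T p j m := (G p j m)^* - (G p m j)^*.

(** This is [theta] of a Hermitian metric as computed in [theta_hermitian], with the metric and its
    Chern coefficients frozen at one point. *)
Definition torsion_map (c : 'I_n -> C) i := \sum_m \sum_k \sum_p \sum_j
  invmx M m i * M k p * T p j m * c k * (c j)^*.

(** The projective relation over one point; 0 stands for [theta] of the locally Minkowski metric,
    and [P] may depend on [e] in any way. *)
Hypothesis rel : forall e : Cn R n, e != 0 -> exists P : C, forall i,
  2^-1 * (\sum_j \sum_l A i l j * coord e l * coord e j) =
  2^-1 * (\sum_j \sum_l G i l j * coord e l * coord e j) +
  2^-1 * (0 - torsion_map (coord e) i) + P * coord e i.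

Let S i l k := G i l k - A i l k.
Let Q i (c : 'I_n -> C) := \sum_l \sum_k S i l k * c l * c k.

(* Replacing [c] by ['i * c] changes the sign of [Q] but not of [torsion_map],
   which separates the two. *)
Lemma quadratic_torsion_radial c i j :
  Q i c * c j = Q j c * c i /\ torsion_map c i * c j = torsion_map c j * c i.
Proof.
have [c0|cn0] := eqVneq (ofcoord c : Cn R n) 0.
  have z k : c k = 0 by rewrite -(coord_ofcoord c) c0 coord0.
  by rewrite !z !mulr0.
have ext (f g : 'I_n -> C) k : f =1 g ->
    Q k f = Q k g /\ torsion_map f k = torsion_map g k.
  by move=> /funext ->.
(* Cross-multiplying two components eliminates the unknown [P]. *)
have X d : (ofcoord d : Cn R n) != 0 ->
    (Q i d - torsion_map d i) * d j = (Q j d - torsion_map d j) * d i.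
  move=> d0; have [P relP] := rel d0.
  have E k : Q k d - torsion_map d k = - 2 * P * d k.
    have := relP k; rewrite !coord_ofcoord.
    have [_ ->] := ext (coord (ofcoord d : Cn R n)) d k (coord_ofcoord d).
    have SS (F : 'I_n -> 'I_n -> C) : \sum_j \sum_l F l j *
       coord (ofcoord d : Cn R n) l * coord (ofcoord d : Cn R n) j =
       \sum_l \sum_j F l j * d l * d j.
      rewrite exchange_big; apply: eq_bigr => l _; apply: eq_bigr => m _ /=.
      by rewrite !coord_ofcoord.
    rewrite !SS => E.
    have -> : Q k d =
        \sum_l \sum_j G k l j * d l * d j - \sum_l \sum_j A k l j * d l * d j.
      rewrite -sumrB; apply: eq_bigr => l _; rewrite -sumrB; apply: eq_bigr => m _.
      by rewrite /S !mulrBl.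
    move: E; move: (\sum_l _) (\sum_l _) (torsion_map d k) (d k) => g a t dk E.
    rewrite -[LHS]half_double.
    transitivity (2 * (2^-1 * g + 2^-1 * (0 - t) + P * dk - 2^-1 * a - P * dk)).
      by move: (2^-1 : C) => h; ring.
    by rewrite -E; move: (2^-1 : C) => h; ring.
  by rewrite !E; ring.
pose d k := 'i * c k.
have d0 : (ofcoord d : Cn R n) != 0.
  apply: contra cn0 => /eqP H; apply/eqP/coord_inj => k; rewrite coord0 coord_ofcoord.
  have := congr1 (fun e => coord e k) H; rewrite coord_ofcoord coord0 => /eqP.
  by rewrite mulf_eq0 (negPf (neq0Ci _)) /= => /eqP.
have i2 : 'i * 'i = -1 :> C by rewrite -expr2 sqrCi.
have Qd k : Q k d = - Q k c.
  rewrite /Q -sumrN; apply: eq_bigr => l _; rewrite -sumrN; apply: eq_bigr => m _.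
  transitivity (('i * 'i) * (S k l m * c l * c m)); first by rewrite /d; ring.
  by rewrite i2 mulN1r.
have Td k : torsion_map d k = torsion_map c k.
  apply: eq_bigr => m _; apply: eq_bigr => k' _.
  apply: eq_bigr => p _; apply: eq_bigr => q _; rewrite /d rmorphM /= conj_i.
  transitivity (- ('i * 'i) * (invmx M m k * M k' p * T p q m * c k' * (c q)^*)).
    by ring.
  by rewrite i2 opprK mul1r.
have E1 := X c cn0; have E2 := X d d0; rewrite !Qd !Td /d in E2.
have {}E2 : (Q i c + torsion_map c i) * c j = (Q j c + torsion_map c j) * c i.
  apply: (mulfI (neq0Ci C)); apply: oppr_inj; rewrite -[RHS]mulrN -[LHS]mulrN.
  transitivity ((- Q i c - torsion_map c i) * ('i * c j)); first by ring.
  by rewrite E2; ring.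
move: E1 E2; move: (Q i c) (Q j c) (torsion_map c i) (torsion_map c j) (c i) (c j).
move=> qi qj ti tj ci cj E1 E2; split; rewrite -[LHS]half_double -[RHS]half_double;
  congr (_ * _).
  transitivity ((qi - ti) * cj + (qi + ti) * cj); first by ring.
  by rewrite E1 E2; ring.
transitivity ((qi + ti) * cj - (qi - ti) * cj); first by ring.
by rewrite E1 E2; ring.
Qed.

Let uM : M \in unitmx := posdef_unitmx pM.

Lemma torsion_map_lower c m : \sum_i torsion_map c i * M i m =
  \sum_k \sum_j (\sum_p M k p * T p j m) * c k * (c j)^*.
Proof.
pose L m := \sum_k \sum_p \sum_j M k p * T p j m * c k * (c j)^*.
have E i : torsion_map c i = \sum_m invmx M m i * L m.
  apply: eq_bigr => m' _; rewrite mulr_sumr; apply: eq_bigr => k _.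
  rewrite mulr_sumr; apply: eq_bigr => p _; rewrite mulr_sumr; apply: eq_bigr => j _.
  by rewrite !mulrA.
transitivity (L m).
  under eq_bigr do rewrite E mulr_suml.
  rewrite exchange_big -[RHS](sum_delta L) /=; apply: eq_bigr => m' _.
  rewrite -(invmx_mulmx m' m uM) mulr_sumr; apply: eq_bigr => i _.
  by rewrite [_ * L _]mulrC mulrA.
apply: eq_bigr => k _; rewrite exchange_big; apply: eq_bigr => j _ /=.
by rewrite !mulr_suml.
Qed.

(** A vector both parallel and orthogonal to a nonzero [c] vanishes. Multiplying by the squared
    length of [c] avoids naming the factor of proportionality. *)
Lemma torsion_map_eq0 c i : torsion_map c i = 0.
Proof.
have [c0|cn0] := eqVneq (ofcoord c : Cn R n) 0.
  have z k : c k = 0 by rewrite -(coord_ofcoord c) c0 coord0.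
  by rewrite /torsion_map; do 4!(rewrite big1 // => ? _); rewrite !z mulr0 mul0r.
(* The torsion is antisymmetric, so that the torsion map is orthogonal to [c]. *)
have orth : \sum_m (\sum_i torsion_map c i * M i m) * (c m)^* = 0.
  under eq_bigr do rewrite torsion_map_lower mulr_suml.
  rewrite exchange_big big1 //= => k _; rewrite -[LHS]half_double.
  under eq_bigr do rewrite mulr_suml.
  rewrite {2}exchange_big -big_split big1 ?mulr0 //= => m _.
  rewrite -big_split big1 //= => j _; rewrite !mulr_suml -big_split big1 //= => p _.
  by rewrite /T; ring.
have N0 : herm_form M (ofcoord c) (ofcoord c) != 0 by rewrite gt_eqF // pM.
apply: (mulIf N0); rewrite mul0r.
transitivity (\sum_m (\sum_i torsion_map c i * M i m) * (c m)^* * c i); last first.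
  by rewrite -mulr_suml orth mul0r.
rewrite /herm_form exchange_big mulr_sumr; apply: eq_bigr => m _ /=.
rewrite mulr_sumr -[RHS]mulrA [RHS]mulr_suml; apply: eq_bigr => j _ /=.
have [_ E] := quadratic_torsion_radial c i j.
rewrite !coord_ofcoord.
transitivity (torsion_map c i * c j * M j m * (c m)^*); first by ring.
by rewrite E; ring.
Qed.

(** The torsion map is sesquilinear in [c], so polarization passes from its values to its
    coefficients, and inverting [M] strips off the metric. *)
Lemma torsion_free p j m : G p j m = G p m j.
Proof.
have L k j' m' : \sum_p M k p * T p j' m' = 0.
  apply: (sesquilinear_eq0 (S := fun k j => \sum_p M k p * T p j m')) => c.
  rewrite -torsion_map_lower big1 // => i _; by rewrite torsion_map_eq0 mul0r.
have T0 : T p j m = 0.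
  rewrite -(sum_delta (fun q => T q j m)).
  transitivity (\sum_q \sum_k invmx M p k * (M k q * T q j m)).
    apply: eq_bigr => q _; rewrite eq_sym -(invmx_mulmx p q uM) mulr_sumr.
    by apply: eq_bigr => k _; rewrite mulrC -!mulrA.
  by rewrite exchange_big big1 //= => k _; rewrite -mulr_sumr L mulr0.
by apply: (inv_inj (@conjCK C)); apply/subr0_eq.
Qed.

(** The radial quadratic map determines its coefficients only once they are symmetric, which for [G]
    is the vanishing of the torsion. *)
Lemma projective_difference i l k : n.+1%:R * (G i l k - A i l k) =
  (\sum_m (G m m l - A m m l)) * (i == k)%:R + (\sum_m (G m m k - A m m k)) * (i == l)%:R.
Proof.
apply: (radial_quadratic_map (S := S)) => [i' l' k'|c i' j'].
  by rewrite /S torsion_free sA.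
by have [] := quadratic_torsion_radial c i' j'.
Qed.

End Projective_relation.

(** * Curvature *)

Section Proportional_tensors.
Context {R : realType} {n : nat}.
Local Notation C := R[i].

Lemma sum_cst (x : C) : \sum_(i < n) x = n%:R * x.
Proof. by rewrite sumr_const card_ord mulr_natl. Qed.

(** Contracting [k] and [m] with the inverse of [M] turns the identity into
    [n * s + s = s + n * kap * M]. *)
Lemma trace_proportional (M : 'M[C]_n) (s : 'I_n -> 'I_n -> C) l j :
  (n%:R : C) != 0 -> M \in unitmx ->
  (forall k m, s l j * M k m + s k j * M l m = s l m * M k j + s k m * M l j) ->
  s l j = n%:R^-1 * (\sum_m \sum_k invmx M m k * s k m) * M l j.
Proof.
move=> cn_neq0 u sM; set kap := n%:R^-1 * _.
have : \sum_m \sum_k invmx M m k * (s l j * M k m + s k j * M l m) =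
  \sum_m \sum_k invmx M m k * (s l m * M k j + s k m * M l j).
  by apply: eq_bigr => m _; apply: eq_bigr => k _; rewrite sM.
have t1 : \sum_m \sum_k invmx M m k * (s l j * M k m) = n%:R * s l j.
  rewrite -sum_cst; apply: eq_bigr => m _.
  transitivity (s l j * (m == m)%:R); last by rewrite eqxx mulr1.
  rewrite -(invmx_mulmx m m u) mulr_sumr; apply: eq_bigr => k _; exact: mulrCA.
have t2 : \sum_m \sum_k invmx M m k * (s k j * M l m) = s l j.
  rewrite exchange_big -[RHS](sum_delta (fun k => s k j)) /=.
  apply: eq_bigr => k _; rewrite eq_sym -(mulmx_invmx l k u) mulr_sumr.
  apply: eq_bigr => m _; rewrite mulrCA; congr (_ * _); exact: mulrC.
have t3 : \sum_m \sum_k invmx M m k * (s l m * M k j) = s l j.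
  rewrite -[RHS](sum_delta (fun m => s l m)).
  apply: eq_bigr => m _; rewrite -(invmx_mulmx m j u) mulr_sumr.
  by apply: eq_bigr => k _; exact: mulrCA.
have t4 : \sum_m \sum_k invmx M m k * (s k m * M l j) =
    n%:R * (kap * M l j).
  rewrite /kap mulrA mulVKf // mulr_suml; apply: eq_bigr => m _.
  by rewrite mulr_suml; apply: eq_bigr => k _; exact: mulrA.
have sp (a b : 'I_n -> 'I_n -> C) : \sum_m \sum_k invmx M m k * (a m k + b m k) =
    \sum_m \sum_k invmx M m k * a m k + \sum_m \sum_k invmx M m k * b m k.
  rewrite -big_split; apply: eq_bigr => m _ /=; rewrite -big_split.
  by apply: eq_bigr => k _ /=; exact: mulrDr.
rewrite (sp (fun m k => s l j * M k m) (fun m k => s k j * M l m)).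
rewrite (sp (fun m k => s l m * M k j) (fun m k => s k m * M l j)).
by rewrite t1 t2 t3 t4 addrC => /addrI/(mulfI cn_neq0).
Qed.

(** Contracting [l] and [j] yields [n * a m = a m]. This is where dimension 1 has to be excluded. *)
Lemma proportional_covector_eq0 (M : 'M[C]_n) (a : 'I_n -> C) m :
  (2 <= n)%N -> M \in unitmx -> (forall l j, a m * M l j = a j * M l m) -> a m = 0.
Proof.
move=> n2 u aM.
have : \sum_j \sum_l invmx M j l * (a m * M l j) =
       \sum_j \sum_l invmx M j l * (a j * M l m).
  by apply: eq_bigr => j _; apply: eq_bigr => l _; rewrite aM.
have -> : \sum_j \sum_l invmx M j l * (a m * M l j) =
    n%:R * a m.
  rewrite -sum_cst; apply: eq_bigr => j _.
  transitivity (a m * (j == j)%:R); last by rewrite eqxx mulr1.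
  rewrite -(invmx_mulmx j j u) mulr_sumr; apply: eq_bigr => l _; exact: mulrCA.
have -> : \sum_j \sum_l invmx M j l * (a j * M l m) = a m.
  rewrite -[RHS](sum_delta (fun j => a j)).
  apply: eq_bigr => j _; rewrite -(invmx_mulmx j m u) mulr_sumr.
  by apply: eq_bigr => l _; exact: mulrCA.
move/eqP; rewrite -subr_eq0 -[X in _ - X]mul1r -mulrBl mulf_eq0 => /orP[|/eqP //].
by rewrite subr_eq0 (eqr_nat _ n 1) gtn_eqF.
Qed.

End Proportional_tensors.

Section Curvature.
Context {R : realType} {n : nat}.
Local Notation C := R[i].
Variables (D : set (Cn R n)) (h : Cn R n -> 'M[C]_n).
Hypothesis n2 : (2 <= n)%N.
Hypothesis oD : open D.
Hypothesis cD : connected D.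
Hypothesis hh : hermitian_metric D h.

Local Notation G := (chern h).
Local Notation hd l m := (fun y => h y l m).
Implicit Types (z : Cn R n) (i j k l m p : 'I_n).

(** Up to sign the Ricci tensor of a Kaehler metric. *)
Let ricci k j z := \sum_i pdbar j (G i i k) z.

Hypothesis kaehler : forall i l k z, D z -> G i l k z = G i k l z.
Hypothesis proj_curv : forall i l k j z, D z ->
  n.+1%:R * pdbar j (G i l k) z = ricci l j z * (i == k)%:R + ricci k j z * (i == l)%:R.

Let sh l m : csmooth D (hd l m) := csmooth_h hh l m.
Let sG i l k : csmooth D (G i l k) := csmooth_chern oD hh i l k.
Let uh z : D z -> h z \in unitmx := @hermitian_unitmx _ _ _ _ hh z.
Let cdh l m z (Dz : D z) : cdifferentiable (hd l m) z :=
  csmooth_cdifferentiable (sh l m) Dz.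
Let cdG i l k z (Dz : D z) : cdifferentiable (G i l k) z :=
  csmooth_cdifferentiable (sG i l k) Dz.

Lemma conj_h l m z : D z -> (h z l m)^* = h z m l.
Proof. by have [_ sy _] := hh; move=> Dz; rewrite [RHS]sy. Qed.

Lemma chern_lower l k m z : D z -> \sum_i h z i m * G i l k z = pd k (hd l m) z.
Proof.
move=> Dz; rewrite /chern; under eq_bigr do rewrite mulr_sumr.
rewrite exchange_big /= -[RHS](sum_delta (fun q => pd k (hd l q) z)).
apply: eq_bigr => q _; rewrite -(invmx_mulmx q m (uh Dz)) mulr_sumr.
by apply: eq_bigr => i _; rewrite mulrA [LHS]mulrC [h z i m * _]mulrC.
Qed.

Lemma pdbar_h j l m z : D z -> pdbar j (hd l m) z = (pd j (hd m l) z)^*.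
Proof.
move=> Dz; rewrite -pdbar_conj; last exact: cdh.
by rewrite !pdbarE; apply: (dop_eq _ _ _ oD) Dz => y Dy; rewrite conj_h.
Qed.

Lemma pd_h_sym k l m z : D z -> pd k (hd l m) z = pd l (hd k m) z.
Proof.
move=> Dz; rewrite -(chern_lower l k m Dz) -(chern_lower k l m Dz).
by apply: eq_bigr => i _; rewrite (kaehler i l k Dz).
Qed.

Lemma pdbar_h_sym j l m z : D z -> pdbar j (hd l m) z = pdbar m (hd l j) z.
Proof.
by move=> Dz; rewrite (pdbar_h j l m Dz) (pdbar_h m l j Dz) (pd_h_sym j m l Dz).
Qed.

(** The Chern curvature tensor with lowered index, opposite in sign to the convention that starts
    with minus the second derivative of [h]. *)
Definition curv l k m j z := \sum_i h z i m * pdbar j (G i l k) z.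

(** Apply [pdbar j] to [chern_lower]. In this form the symmetry in the barred indices and the
    Hermitian symmetry can be checked term by term. *)
Lemma curvE l k m j z : D z -> curv l k m j z =
  pdbar j (pd k (hd l m)) z - \sum_i \sum_p h z i p * (G p m j z)^* * G i l k z.
Proof.
move=> Dz.
have -> : pdbar j (pd k (hd l m)) z = pdbar j (fun y => \sum_i h y i m * G i l k y) z.
  rewrite !pdbarE; apply: (dop_eq _ _ _ oD) Dz => y Dy; exact/esym/chern_lower.
have cd i : cdifferentiable (fun y => h y i m * G i l k y) z.
  by apply: cdifferentiableM; [exact: cdh | exact: cdG].
rewrite pdbarE dop_sum // /curv -sumrB; apply: eq_bigr => i _.
rewrite dopM; [|exact: cdh|exact: cdG].
rewrite -!pdbarE (pdbar_h j i m Dz) -(chern_lower m j i Dz) rmorph_sum /= mulr_suml.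
rewrite -[LHS]addr0 -addrA; congr (_ + _); apply/esym/eqP; rewrite subr_eq0.
by apply/eqP/eq_bigr => p _; rewrite rmorphM /= conj_h.
Qed.

Lemma curv_sym l k m j z : D z -> curv l k m j z = curv l k j m z.
Proof.
move=> Dz; rewrite (curvE l k m j Dz) (curvE l k j m Dz).
apply: (congr2 (fun a b => a - b)); last first.
  by apply: eq_bigr => i _; apply: eq_bigr => p _; rewrite (kaehler p m j Dz).
rewrite -(pd_pdbar_comm k j oD (sh l m) Dz) -(pd_pdbar_comm k m oD (sh l j) Dz) !pdE.
by apply: (dop_eq _ _ _ oD) Dz => y Dy; exact: pdbar_h_sym.
Qed.

Lemma curv_conj l k m j z : D z -> (curv l k m j z)^* = curv m j l k z.
Proof.
move=> Dz; rewrite (curvE l k m j Dz) (curvE m j l k Dz) rmorphB.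
apply: (congr2 (fun a b => a - b)); last first.
  rewrite rmorph_sum exchange_big /=; apply: eq_bigr => i _.
  rewrite rmorph_sum /=; apply: eq_bigr => p _.
  by rewrite !rmorphM /= conjCK conj_h // mulrAC.
have cd : cdifferentiable (pd k (hd l m)) z.
  by apply: csmooth_cdifferentiable Dz; exact: csmooth_pd.
apply: (etrans (esym (pd_conj j cd))).
rewrite -(pd_pdbar_comm j k oD (sh m l) Dz) !pdE.
apply: (dop_eq _ _ _ oD) Dz => y Dy.
by rewrite -pdE (pdbar_h k m l Dy).
Qed.

Let c1 : C := n.+1%:R.

Lemma curv_ricci l k m j z : D z ->
  c1 * curv l k m j z = ricci l j z * h z k m + ricci k j z * h z l m.
Proof.
move=> Dz; rewrite /curv mulr_sumr.
transitivity (\sum_i (ricci l j z * h z i m * (i == k)%:R +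
                      ricci k j z * h z i m * (i == l)%:R)).
  apply: eq_bigr => i _; rewrite mulrCA proj_curv //.
  by move: (ricci l j z) (ricci k j z) => *; ring.
rewrite big_split /=; congr (_ + _).
  exact: (sum_delta (fun i => ricci l j z * h z i m)).
exact: (sum_delta (fun i => ricci k j z * h z i m)).
Qed.

(* [n.+1] times the kappa of the introduction, [ricci] being an unnormalised trace. *)
Definition kap z : C := n%:R^-1 * \sum_m \sum_k invmx (h z) m k * ricci k m z.

Let cn_neq0 : (n%:R : C) != 0.
Proof. by rewrite pnatr_eq0 -lt0n (leq_trans _ n2). Qed.

(** By [curv_sym] the right-hand side of [curv_ricci] is symmetric in [m] and [j]; that is the
    identity solved by [trace_proportional]. *)
Lemma ricci_kap l j z : D z -> ricci l j z = kap z * h z l j.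
Proof.
move=> Dz; apply: trace_proportional cn_neq0 (uh Dz) _ => k m.
exact: etrans (esym (curv_ricci l k m j Dz))
  (etrans (congr1 ( *%R c1) (curv_sym l k m j Dz)) (curv_ricci l k j m Dz)).
Qed.

Lemma curv_kap l k m j z : D z ->
  c1 * curv l k m j z = kap z * (h z l j * h z k m + h z k j * h z l m).
Proof. by move=> Dz; rewrite curv_ricci // !ricci_kap // mulrDr !mulrA. Qed.

Let i0 : 'I_n := Ordinal (leq_trans (isT : (0 < 2)%N) n2).

Lemma h_diag_neq0 z i : D z -> h z i i != 0.
Proof.
move=> Dz; have [_ _ pd] := hh.
have e0 : ofcoord (fun k => (k == i)%:R) != 0 :> Cn R n.
  apply/eqP => E; have := congr1 (fun e => coord e i) E.
  by rewrite coord_ofcoord coord0 eqxx => /eqP; rewrite oner_eq0.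
have := pd z Dz _ e0.
suff -> : herm_form (h z) (ofcoord (fun k => (k == i)%:R))
    (ofcoord (fun k => (k == i)%:R)) =
  h z i i by move=> /lt0r_neq0.
rewrite /herm_form -[RHS](sum_delta (fun k => h z k i)); apply: eq_bigr => k _.
rewrite -(sum_delta (fun m => h z k m)) mulr_suml; apply: eq_bigr => m _.
by rewrite !coord_ofcoord rmorph_nat mulrAC.
Qed.

(** One diagonal component suffices: [curv] is real there by [curv_conj], and the coefficient of
    [kap], twice the square of [h z i0 i0], is real and nonzero. *)
Lemma conj_kap z : D z -> (kap z)^* = kap z.
Proof.
move=> Dz; have E := curv_kap i0 i0 i0 i0 Dz; have := congr1 (fun x => x^*) E.
rewrite /= !rmorphM rmorphD !rmorphM /= (curv_conj i0 i0 i0 i0 Dz).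
rewrite (conj_h i0 i0 Dz) /c1 rmorph_nat E; move=> /esym/mulIf; apply.
rewrite -mulr2n mulrn_eq0 /= mulf_eq0 orbb; exact: h_diag_neq0.
Qed.

Lemma csmooth_ricci k j : csmooth D (ricci k j).
Proof. by apply: csmooth_sum => // i; exact: csmooth_pdbar. Qed.

Lemma csmooth_kap : csmooth D kap.
Proof.
apply: csmoothM => //; first exact: csmooth_cst.
apply: csmooth_sum => // m; apply: csmooth_sum => // k; apply: csmoothM => //.
  by apply: csmooth_invmx.
exact: csmooth_ricci.
Qed.

Lemma pdbar_ricci k j m z : D z -> pdbar m (ricci k j) z = pdbar j (ricci k m) z.
Proof.
move=> Dz; have cd i q : cdifferentiable (pdbar q (G i i k)) z.
  by apply: csmooth_cdifferentiable Dz; exact: csmooth_pdbar.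
have S q r : pdbar q (ricci k r) z = \sum_i pdbar q (pdbar r (G i i k)) z.
  transitivity (dop 'i (ex q) (ey q) (fun y => \sum_i pdbar r (G i i k) y) z) => //.
  exact: (dop_sum _ _ _ (fun i => cd i r)).
rewrite (S m j) (S j m); apply: eq_bigr => i _.
exact: (pdbar_comm m j oD (sG i i k) Dz).
Qed.

(** Schur's argument: differentiate [ricci_kap] and exchange the two barred indices. The terms with
    a derivative of [h] agree because [h] is Kaehler, so the covector [pdbar m kap] satisfies
    [proportional_covector_eq0]. *)
Lemma pdbar_kap m z : D z -> pdbar m kap z = 0.
Proof.
move=> Dz.
have ck : cdifferentiable kap z by exact: csmooth_cdifferentiable csmooth_kap Dz.
have P l j q : pdbar q (ricci l j) z =
    kap z * pdbar q (hd l j) z + pdbar q kap z * h z l j.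
  transitivity (pdbar q (fun y => kap y * h y l j) z).
    by rewrite !pdbarE; apply: (dop_eq _ _ _ oD) Dz => y Dy; exact: ricci_kap.
  transitivity (dop 'i (ex q) (ey q) (fun y => kap y * h y l j) z) => //.
  exact: (dopM _ _ _ ck (cdh l j Dz)).
have E l j : pdbar m kap z * h z l j = pdbar j kap z * h z l m.
  have := pdbar_ricci l j m Dz; rewrite (P l j m) (P l m j) (pdbar_h_sym m l j Dz).
  exact: addrI.
exact: (proportional_covector_eq0 (a := fun m => pdbar m kap z) n2 (uh Dz) E).
Qed.

(** For a real function [pd] is the conjugate of [pdbar], so all derivatives of [kap] vanish and
    connectedness applies. *)
Lemma kap_cst : exists c : R, forall z, D z -> kap z = c%:C.
Proof.
have ck z (Dz : D z) : cdifferentiable kap z := csmooth_cdifferentiable csmooth_kap Dz.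
have D0 z v : D z -> cderive v kap z = 0.
  move=> Dz; rewrite cderive_pd; last exact: ck.
  rewrite big1 // => k _; rewrite pdbar_kap // mulr0 addr0.
  have -> : pd k kap z = pd k (fun y => (kap y)^*) z.
    by rewrite !pdE; apply: (dop_eq _ _ _ oD) Dz => y Dy; rewrite conj_kap.
  by rewrite pd_conj ?pdbar_kap ?conjC0 ?mulr0 //; exact: ck.
have [[z0 Dz0]|D00] := pselect (D !=set0); last first.
  by exists 0 => z Dz; case: D00; exists z.
exists (Re (kap z0)) => z Dz.
have Rz : Re (kap z) = Re (kap z0).
  have dR y : D y -> differentiable (fun y => Re (kap y)) y by move=> /ck[].
  have DR y v : D y -> 'D_v (fun y => Re (kap y)) y = 0.
    by move=> Dy; exact: (congr1 (@complex.Re R) (D0 y v Dy)).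
  exact: (derive0_connected_cst oD cD dR DR Dz Dz0).
apply: complex_ext; first exact: Rz.
rewrite Im_real; have := congr1 (@complex.Im R) (conj_kap Dz); rewrite Im_conj => /eqP.
by rewrite eqNr => /eqP.
Qed.

(** Each of the two terms of [curv_kap] contributes one square of the form, whence the factor 2. *)
Lemma curv_contract z (e : Cn R n) : D z ->
  c1 * (\sum_k \sum_m \sum_p \sum_j \sum_l h z k m * pdbar p (G k l j) z *
      coord e l * coord e j * (coord e p)^* * (coord e m)^*) =
  2 * kap z * herm_form (h z) e e ^+ 2.
Proof.
move=> Dz.
transitivity (\sum_m \sum_p \sum_j \sum_l c1 * curv l j m p z *
    coord e l * coord e j * (coord e p)^* * (coord e m)^*).
  rewrite exchange_big mulr_sumr; apply: eq_bigr => m _ /=.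
  rewrite exchange_big mulr_sumr; apply: eq_bigr => p _ /=.
  rewrite exchange_big mulr_sumr; apply: eq_bigr => j _ /=.
  rewrite exchange_big mulr_sumr; apply: eq_bigr => l _ /=.
  rewrite /curv !mulr_sumr !mulr_suml; apply: eq_bigr => k _; by rewrite !mulrA.
have H : herm_form (h z) e e = \sum_p \sum_l h z l p * coord e l * (coord e p)^*.
  by rewrite /herm_form exchange_big.
transitivity (\sum_m \sum_p (kap z *
   ((\sum_l h z l p * coord e l * (coord e p)^*) *
    (\sum_j h z j m * coord e j * (coord e m)^*) +
    (\sum_l h z l m * coord e l * (coord e m)^*) *
    (\sum_j h z j p * coord e j * (coord e p)^*)))).
  apply: eq_bigr => m _; apply: eq_bigr => p _.
  rewrite !mulr_sumr -big_split mulr_sumr; apply: eq_bigr => j _ /=.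
  rewrite !mulr_suml -big_split mulr_sumr; apply: eq_bigr => l _ /=.
  rewrite curv_kap //.
  move: (kap z) (coord e l) (coord e j) ((coord e p)^*) ((coord e m)^*).
  by move=> *; ring.
have HH (a : 'I_n -> C) : \sum_m \sum_p kap z * (a p * a m + a m * a p) =
    2 * kap z * (\sum_p a p) ^+ 2.
  rewrite expr2 [X in _ * X]mulr_suml mulr_sumr; apply: eq_bigr => m _.
  rewrite mulr_sumr mulr_sumr; apply: eq_bigr => p _; ring.
by rewrite HH -H.
Qed.

End Curvature.

(** * Constant multiples of the norm of [h], and the proof of the theorem *)

Section Homothety.
Context {R : realType} {n : nat}.
Local Notation C := R[i].
Variables (D : set (Cn R n)) (h : Cn R n -> 'M[C]_n).
Hypothesis oD : open D.
Hypothesis hh : hermitian_metric D h.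

(** Covers both metrics of the theorem: the norm of [h] with factor 1, and [F] with the constant
    value of [rho]. *)
Definition scaled_norm (r : R) (F : TCn R n -> R) :=
  0 < r /\ forall z e, D z -> F (z, e) = r * hnorm h (z, e).

Lemma projectively_related_scaled r r' F F' Ft : scaled_norm r F -> scaled_norm r' F' ->
  projectively_related D F Ft -> projectively_related D F' Ft.
Proof.
move=> [r0 hF] [r0' hF'] [P [sP rel]]; exists P; split; first exact: sP.
move=> i [z e] [/= Dz e0]; apply: (etrans (rel i (z, e) (conj Dz e0))).
rewrite (spray_hermitian oD hh r0 hF i Dz e0) (theta_hermitian oD hh r0 hF i Dz e0).
rewrite (spray_hermitian oD hh r0' hF' i Dz e0) (theta_hermitian oD hh r0' hF' i Dz e0).
exact: erefl.
Qed.

Lemma locally_projectively_flat_scaled r r' F F' : scaled_norm r F -> scaled_norm r' F' ->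
  locally_projectively_flat D F -> locally_projectively_flat D F'.
Proof.
move=> hF hF' [Ft [cF mF pF]]; exists Ft.
exact: And3 cF mF (projectively_related_scaled hF hF' pF).
Qed.

Section Flat.
Variables (F : TCn R n -> R) (r : R).
Hypothesis hF : scaled_norm r F.
Hypothesis flat : locally_projectively_flat D F.

(** The one place where the locally Minkowski metric is opened up; from here on it survives only as
    the local array [A]. *)
Lemma flat_connection z0 : D z0 ->
  exists (U : set (Cn R n)) (A : 'I_n -> 'I_n -> 'I_n -> Cn R n -> C),
  [/\ [/\ open U, U z0 & U `<=` D],
    forall i l k, csmooth U (A i l k),
    forall i l k j z, U z -> pdbar j (A i l k) z = 0,
    forall i l k z, U z -> chern h i l k z = chern h i k l z
  & forall i l k z, U z -> n.+1%:R * (chern h i l k z - A i l k z) =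
      (\sum_m (chern h m m l z - A m m l z)) * (i == k)%:R +
      (\sum_m (chern h m m k z - A m m k z)) * (i == l)%:R].
Proof.
move=> Dz0; have [r0 hF'] := hF; have [Ft [cF mF [P [_ rel]]]] := flat.
have [U [A [[oU Uz0 UD] sA syA hA NA]]] := minkowski_connection cF mF Dz0.
exists U, A.
have pM z : U z -> posdef (h z) by have [_ _ pd] := hh; move=> /UD; exact: pd.
have relA z : U z -> forall e : Cn R n, e != 0 -> exists P : C, forall i,
    2^-1 * (\sum_j \sum_l A i l j z * coord e l * coord e j) =
    2^-1 * (\sum_j \sum_l chern h i l j z * coord e l * coord e j) +
    2^-1 * (0 - torsion_map (h z) (fun i l k => chern h i l k z) (coord e) i) +
    P * coord e i.
  move=> Uz e e0; exists (P (z, e)) => i; have Dz := UD z Uz.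
  have := rel i (z, e) (conj Dz e0).
  have t0 : theta Ft i (z, e) = 0.
    rewrite (theta_linear NA i Uz e0); do 4!(rewrite big1 // => ? _).
    by rewrite (syA _ _ _ _ Uz) subrr mulr0 !mul0r.
  rewrite t0 (spray_linear NA i Uz e0) (spray_hermitian oD hh r0 hF' i Dz e0).
  rewrite (theta_hermitian oD hh r0 hF' i Dz e0).
  exact: id.
split; [exact: And3 oU Uz0 UD | exact: sA | exact: hA | |] => i l k z Uz.
  exact: (torsion_free (pM z Uz) (relA z Uz)).
exact: (projective_difference (A := fun i l k => A i l k z) (pM z Uz)
  (fun i l k => syA i l k z Uz) (relA z Uz)).
Qed.

Lemma flat_kaehler i l k z : D z -> chern h i l k z = chern h i k l z.
Proof.
by move=> Dz; have [U [A [[_ Uz _] _ _ sG _]]] := flat_connection Dz; exact: sG.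
Qed.

(** This is [pdbar j] of the projective difference over a small open set. As [A] is holomorphic,
    nothing of that local choice remains. *)
Lemma flat_curvature i l k j z : D z -> n.+1%:R * pdbar j (chern h i l k) z =
  (\sum_m pdbar j (chern h m m l) z) * (i == k)%:R +
  (\sum_m pdbar j (chern h m m k) z) * (i == l)%:R.
Proof.
move=> Dz; have [U [A [[oU Uz UD] sA hA _ diff]]] := flat_connection Dz.
have cA a b c : cdifferentiable (A a b c) z.
  exact: csmooth_cdifferentiable (sA _ _ _) Uz.
have cG a b c : cdifferentiable (chern h a b c) z.
  exact: csmooth_cdifferentiable (csmooth_chern oD hh a b c) Dz.
pose dif a b c y := chern h a b c y + -1 * A a b c y.
have cA' a b c : cdifferentiable (fun y => -1 * A a b c y) z.
  by apply: cdifferentiableM; [exact: cdifferentiable_cst | exact: cA].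
have cd a b c : cdifferentiable (dif a b c) z.
  by apply: cdifferentiableD; [exact: cG | exact: cA'].
have pd a b c : pdbar j (dif a b c) z = pdbar j (chern h a b c) z.
  rewrite pdbarE; apply: (etrans (dopD _ _ _ (cG a b c) (cA' a b c))).
  rewrite dopMl; last exact: cA.
  by rewrite -!pdbarE hA // mulr0 addr0.
have cds b : cdifferentiable (fun y => \sum_m dif m m b y) z.
  exact: cdifferentiable_sum.
have pds b : pdbar j (fun y => \sum_m dif m m b y) z = \sum_m pdbar j (chern h m m b) z.
  rewrite pdbarE; apply: (etrans (dop_sum _ _ _ (fun m => cd m m b))).
  by apply: eq_bigr => m _; exact: pd.
have cdd b (x : C) : cdifferentiable (fun y => (\sum_m dif m m b y) * x) z.
  by apply: cdifferentiableM; [exact: cds | exact: cdifferentiable_cst].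
transitivity (pdbar j (fun y => n.+1%:R * dif i l k y) z).
  by rewrite -(pd i l k) !pdbarE; exact: (esym (dopMl _ _ _ _ (cd i l k))).
transitivity (pdbar j (fun y => (\sum_m dif m m l y) * (i == k)%:R +
    (\sum_m dif m m k y) * (i == l)%:R) z); last first.
  have pdd b x : pdbar j (fun y => (\sum_m dif m m b y) * x) z =
      (\sum_m pdbar j (chern h m m b) z) * x.
    rewrite -(pds b); exact: (dopMr 'i (ex j) (ey j) x (cds b)).
  apply: (etrans (dopD 'i (ex j) (ey j) (cdd l _) (cdd k _))).
  exact: (congr2 (fun x y => x + y) (pdd l _) (pdd k _)).
rewrite !pdbarE; apply: (dop_eq _ _ _ oU) Uz => y Uy.
have E a b c : dif a b c y = chern h a b c y - A a b c y by rewrite /dif mulN1r.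
rewrite E (diff i l k y Uy); congr (_ * _ + _ * _); apply: eq_bigr => m _; exact/esym/E.
Qed.

(** The constant is chosen before [r'] and [F'], so that the same [c] serves [h] and [F]. *)
Lemma flat_hol_curvature : (2 <= n)%N -> connected D ->
  exists c : R, forall r' F', scaled_norm r' F' ->
    forall z e, D z -> e != 0 -> hol_curvature F' (z, e) = ((r' ^+ 2)^-1 * c)%:C.
Proof.
move=> n2 cD.
have [k0 kE] := kap_cst n2 oD cD hh flat_kaehler flat_curvature.
(* The 2 of [curv_contract] cancels the half in the spray, leaving the -4 of the holomorphic
   curvature; [k0] is a value of [kap], so [n.+1] is divided out. *)
exists (- 4 * k0 / n.+1%:R) => r' F' [r0 hF'] z e Dz e0.
have N0 : hnorm h (z, e) != 0.
  have [_ _ pd] := hh; have := pd z Dz e e0; rewrite -(hnorm_sqr hh) // => H.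
  by apply: contraTneq H => ->; rewrite expr0n /= ltxx.
have c1 : (n.+1%:R : C) != 0 by rewrite pnatr_eq0.
have c1' : (n.+1%:R : R) != 0 by rewrite pnatr_eq0.
rewrite (hol_curvature_hermitian oD hh r0 hF') //.
have := curv_contract n2 oD hh flat_kaehler flat_curvature e Dz.
rewrite -(hnorm_sqr hh) // kE //; move: (\sum_k _) => S HS.
have -> : S = (2 * k0 * (hnorm h (z, e) ^+ 2) ^+ 2 / n.+1%:R)%:C.
  apply: (mulfI c1); rewrite HS !(rmorphM, rmorphXn, fmorphV, rmorph_nat) /=.
  by rewrite [RHS]mulrC divfK.
have r0' : r' != 0 by rewrite gt_eqF.
have -> : (4 : C) = (4 : R)%:C by rewrite rmorph_nat.
have -> : (2^-1 : C) = (2^-1 : R)%:C by rewrite fmorphV rmorph_nat.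
rewrite -fmorphV -!rmorphM -rmorphN -rmorphM; congr (_%:C).
move: (hnorm h (z, e)) (n.+1%:R : R) N0 c1' => N m N0 m0.
by field; rewrite ?N0 ?m0 ?r0'.
Qed.

End Flat.
End Homothety.

Theorem corollary4p17 (R : realType) (n : nat) (hn : (2 <= n)%N)
    (D : set (Cn R n)) (h : Cn R n -> 'M[R[i]]_n)
    (u : Cn R n -> R) (W : Cn R n -> Cn R n)
    (rho : Cn R n -> R) (F : TCn R n -> R) :
  domain D ->
  navigation_data D h u W ->
  conformal_solution D h u W rho F ->
  homothetic D rho ->
  (locally_projectively_flat D (hnorm h) <-> locally_projectively_flat D F) /\
  (locally_projectively_flat D (hnorm h) \/ locally_projectively_flat D F ->
   exists c : R, forall z eta : Cn R n, D z -> eta != 0 ->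
     hol_curvature (hnorm h) (z, eta) = c%:C /\
     hol_curvature F (z, eta) = ((rho z ^+ 2)^-1 * c)%:C).
Proof.
move=> [oD cD [z0 Dz0]] [hh _ _ hW] [phi [_ hrho hF]] [r rE].
(* Read off at the single point [z0]: the speed exceeds the norm of the wind, so it is positive in
   the first case, and the radicand is positive in the second. *)
have r0 : 0 < r.
  rewrite -(rE z0 Dz0); have [Wu _] := hW z0 Dz0.
  have W0 : 0 <= hnorm h (z0, W z0) by exact: sqrtr_ge0.
  case: hrho => [H|[_ H]]; have [_ ->] := H z0 Dz0; rewrite invr_gt0.
    exact: le_lt_trans Wu.
  rewrite sqrtr_gt0 subr_gt0 ltr_pXn2r // nnegrE //.
  exact: le_trans (ltW Wu).
have s1 : scaled_norm D h 1 (hnorm h) by split=> // z e _; rewrite mul1r.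
have sF : scaled_norm D h r F by split=> // z e Dz; rewrite hF // rE.
have equiv : locally_projectively_flat D (hnorm h) <-> locally_projectively_flat D F.
  by split; [exact: (locally_projectively_flat_scaled oD hh s1 sF)
    |exact: (locally_projectively_flat_scaled oD hh sF s1)].
split=> // flat.
have flat1 : locally_projectively_flat D (hnorm h).
  by case: flat => [fl|fl]; [exact: fl | exact: (equiv.2 fl)].
have [c cE] := flat_hol_curvature oD hh s1 flat1 hn cD.
exists c => z e Dz e0; split; last by rewrite (cE r F sF z e Dz e0) rE.
by rewrite (cE 1 _ s1 z e Dz e0) expr1n invr1 mul1r.
Qed.
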